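(* Let $n\ge 3$, let $Z\subset\mathbb{R}^n$ be an analytic set with $\dim Z\le n-2$, and let $\Sigma\subset S^{n-1}$ be an $(n-2)$-dimensional $C^2$ manifold which has non-vanishing geodesic curvature if $n=3$, and sectional curvature $>1$ if $n\ge 4$. Then for every $s$ with $0<s<\dim Z$, $$\dim\{x\in\Sigma : \dim[\pi_{T_xS^{n-1}}(Z)]<s\}\le s.$$ In particular, $\dim[\pi_{T_xS^{n-1}}(Z)]=\dim Z$ for $\mathcal{H}^{n-2}$-a.e. $x\in\Sigma$.
   Context: $\dim$ denotes Hausdorff dimension and $\mathcal{H}^{n-2}$ the $(n-2)$-dimensional Hausdorff measure. $S^{n-1}$ is the unit sphere of $\mathbb{R}^n$. $T_xS^{n-1}$ is the tangent space of the sphere at $x$, viewed as the linear hyperplane $x^\perp\subset\mathbb{R}^n$. $\pi_W:\mathbb{R}^n\to W$ is the orthogonal projection onto a linear subspace $W$. $\Sigma$ is an embedded $C^2$ submanifold of $S^{n-1}$ (a curve in $S^2$ when $n=3$). Geodesic curvature is that of a curve in $S^2$. For $n\ge4$, sectional curvature is with respect to the induced metric; by the Gauss equation the sectional curvature of the plane spanned by two principal directions $\xi_i,\xi_j$ is $\kappa_i\kappa_j+1$, with $\kappa_1,\dots,\kappa_{n-2}$ the principal curvatures of $\Sigma$ in $S^{n-1}$, so the assumption is equivalent to all principal curvatures at each point being nonzero and of the same sign. *)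

(* Defs.v *)
From HB Require Import structures.
From mathcomp Require Export all_boot all_order all_algebra.
From mathcomp Require Export all_classical all_reals all_analysis.
Export numFieldNormedType.Exports.
Export Order.TTheory GRing.Theory Num.Theory.

Set Implicit Arguments.
Unset Strict Implicit.
Unset Printing Implicit Defensive.

Local Open Scope classical_set_scope.
Local Open Scope ring_scope.

(* R^n is 'rV[R]_n. Its library norm is the sup norm; it is used only for the
   topology and for derivatives. Everything metric below is Euclidean. *)

Definition edot (R : realType) (n : nat) (u v : 'rV[R]_n) : R :=
  \sum_(i < n) u 0 i * v 0 i.

Definition enorm (R : realType) (n : nat) (u : 'rV[R]_n) : R :=
  Num.sqrt (edot u u).

Definition sphere (R : realType) (n : nat) : set 'rV[R]_n :=
  [set x | enorm x = 1].
Arguments sphere : clear implicits.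

(* Linear subspaces are row spaces of matrices, as in mxalgebra. The row space
   of orthc W consists of all v with v *m W^T = 0. *)
Definition orthc (R : realType) (p n : nat) (W : 'M[R]_(p, n)) : 'M[R]_n :=
  kermx W^T.

(* The projection acts on row vectors on the right: z |-> z *m orthproj W. *)
Definition orthproj (R : realType) (p n : nat) (W : 'M[R]_(p, n)) : 'M[R]_n :=
  proj_mx <<W>>%MS (orthc W).

Definition tangent_sphere (R : realType) (n : nat) (x : 'rV[R]_n) : 'M[R]_n :=
  orthc x.

(* On the empty set this is -oo. *)
Definition ediam (R : realType) (n : nat) (A : set 'rV[R]_n) : \bar R :=
  ereal_sup [set (enorm (p.1 - p.2))%:E | p in A `*` A].

(* The test for set0 only matters when s = 0, where the library's convention
   is 0 `^ 0 = 1: singletons then weigh 1 and the empty set weighs 0. *)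
Definition hgauge (R : realType) (n : nat) (s : R) (A : set 'rV[R]_n) : \bar R :=
  if A == set0 then 0%E else poweR (ediam A) s.

Definition hausdorff_premeasure (R : realType) (n : nat) (s delta : R)
    (A : set 'rV[R]_n) : \bar R :=
  ereal_inf [set (\sum_(0 <= i <oo) hgauge s (F i))%E | F in
    [set F : nat -> set 'rV[R]_n | A `<=` \bigcup_i F i /\
       forall i, (ediam (F i) <= delta%:E)%E]].

(* Not normalised by the volume of the unit ball. *)
Definition hausdorff_measure (R : realType) (n : nat) (s : R)
    (A : set 'rV[R]_n) : \bar R :=
  ereal_sup [set hausdorff_premeasure s delta A | delta in
    [set delta : R | 0 < delta]].

Definition hausdorff_dim (R : realType) (n : nat) (A : set 'rV[R]_n) : \bar R :=
  ereal_inf [set s%:E | s in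
    [set s : R | 0 <= s /\ hausdorff_measure s A = 0%E]].

(* Analytic (Suslin) sets: the empty set and the continuous images of the
   Baire space. *)
Definition analytic_set (R : realType) (n : nat) (A : set 'rV[R]_n) : Prop :=
  A = set0 \/
  exists f : prod_topology (fun _ : nat => nat) -> 'rV[R]_n,
    continuous f /\ range f = A.

Definition C2_on (R : realType) (m n : nat) (U : set 'rV[R]_m)
    (phi : 'rV[R]_m -> 'rV[R]_n) : Prop :=
  [/\ (forall u, U u -> differentiable phi u),
      (forall a u, U u -> differentiable ('D_a phi) u) &
      (forall a b u, U u -> {for u, continuous ('D_b ('D_a phi))})].

(* The last clause, applied to all open W `<=` U, says that phi is open as a
   map from U to Sigma with its subspace topology: phi is a homeomorphism from
   U onto a relatively open subset of Sigma. *)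
Definition local_param (R : realType) (m n : nat) (Sigma : set 'rV[R]_n)
    (U : set 'rV[R]_m) (phi : 'rV[R]_m -> 'rV[R]_n) : Prop :=
  [/\ open U,
      C2_on U phi,
      (forall u v, U u -> U v -> phi u = phi v -> u = v),
      (forall u, U u -> row_free ('J phi u)) &
      (forall W, open W -> W `<=` U ->
         exists2 V : set 'rV[R]_n, open V & phi @` W = Sigma `&` V)].

(* Embedded, without boundary. *)
Definition C2_submanifold (R : realType) (m n : nat) (Sigma : set 'rV[R]_n) :
    Prop :=
  forall x, Sigma x ->
    exists (U : set 'rV[R]_m) (phi : 'rV[R]_m -> 'rV[R]_n),
      local_param Sigma U phi /\ (phi @` U) x.
Arguments C2_submanifold {R} m {n} Sigma.

(* The second fundamental form in R^n, in a local parametrization: the normal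
   component of the second derivative. The rows of 'J phi u span the tangent
   space at phi u. *)
Definition second_ff (R : realType) (m n : nat) (phi : 'rV[R]_m -> 'rV[R]_n)
    (u a b : 'rV[R]_m) : 'rV[R]_n :=
  'D_b ('D_a phi) u *m orthproj (orthc ('J phi u)).

(* Absolute value of the geodesic curvature, in the unit sphere, of the regular
   curve phi: the part of phi'' which is normal to phi' and tangent to the
   sphere, rescaled by |phi'|^2. *)
Definition geodesic_curvature (R : realType) (n : nat)
    (phi : 'rV[R]_1 -> 'rV[R]_n) (u : 'rV[R]_1) : R :=
  enorm (second_ff phi u 1 1 *m orthproj (tangent_sphere (phi u)))
    / enorm ('D_1 phi u) ^+ 2.

Definition nonvanishing_geodesic_curvature (R : realType) (n : nat)
    (Sigma : set 'rV[R]_n) : Prop :=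
  forall (U : set 'rV[R]_1) (phi : 'rV[R]_1 -> 'rV[R]_n),
    local_param Sigma U phi ->
    forall u, U u -> geodesic_curvature phi u != 0.

(* Sectional curvature, for the metric induced from R^n, of the tangent plane
   spanned by the derivatives of phi along a and b. The induced metric of a C^2
   submanifold is only C^1, so its curvature is given by the Gauss equation. *)
Definition sectional_curvature (R : realType) (m n : nat)
    (phi : 'rV[R]_m -> 'rV[R]_n) (u a b : 'rV[R]_m) : R :=
  let g := fun v w : 'rV[R]_m => edot ('D_v phi u) ('D_w phi u) in
  let II := second_ff phi u in
  (edot (II a a) (II b b) - edot (II a b) (II a b))
    / (g a a * g b b - g a b ^+ 2).

Definition sectional_curvature_gt1 (R : realType) (m n : nat)
    (Sigma : set 'rV[R]_n) : Prop :=
  forall (U : set 'rV[R]_m) (phi : 'rV[R]_m -> 'rV[R]_n),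
    local_param Sigma U phi ->
    forall u a b, U u -> row_free (col_mx a b) ->
      1 < sectional_curvature phi u a b.
Arguments sectional_curvature_gt1 {R} m {n} Sigma.

Definition tproj (R : realType) (n : nat) (x : 'rV[R]_n) (Z : set 'rV[R]_n) :
    set 'rV[R]_n :=
  [set z *m orthproj (tangent_sphere x) | z in Z].

(* Main.v *)
Require Import Defs.
From mathcomp Require Import zify ring lra.

(* For a unit vector x, the projection of v onto the hyperplane orthogonal to x
   has norm less than r only if x is at distance O(r/|v|) from v/|v| or -v/|v|.
   This is the transversality needed for Kaufman's argument. Let s < t < u < dim Z,
   and let mu on Z and nu on the set of exceptional directions be Frostman measures
   of exponents u and t. Integrating over nu the mu x mu measure of the pairs of
   points that are 2^-j close after projection gives O(2^(-jt)). If the projection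
   along x is H^s-null, then for some large j about 2^(js) tubes of width 2^-j in
   the direction x carry a j-summable proportion of mu, which gives at least about
   2^(-js) for that x; hence the exceptional set is null for the exponent t.

   Only finitely supported measures at a dyadic scale are used, so that the
   exceptional set may be arbitrary: dyadic content is strongly subadditive,
   hence continuous along increasing sequences of arbitrary sets (Choquet), and
   this both replaces the analytic set Z by an essentially compact part of it and
   removes the dependence of the scale on x. *)

Set Implicit Arguments.
Unset Strict Implicit.
Unset Printing Implicit Defensive.

Local Open Scope classical_set_scope.
Local Open Scope ring_scope.

(** * Dyadic content *)

Definition cell (R : realType) (n l : nat) (x : 'rV[R]_n) : 'rV[int]_n :=
  \row_i Num.floor (2 ^+ l * x 0 i).

Lemma cell_nested (R : realType) (n k l : nat) (x y : 'rV[R]_n) :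
  (k <= l)%N -> cell l x = cell l y -> cell k x = cell k y.
Proof.
have floor_half (u v : R) :
    Num.floor (2 * u) = Num.floor (2 * v) -> (Num.floor u <= Num.floor v)%R.
  move=> e; rewrite floor_ge_int -(@ler_pM2l _ 2) //.
  have -> : 2 * (Num.floor u)%:~R = (2 * Num.floor u)%:~R :> R by rewrite intrM.
  rewrite -floor_ge_int -e floor_ge_int intrM ler_pM2l //.
  exact: floor_le.
move=> /subnK <-; elim: (l - k)%N => [|d IH] //= e.
apply: IH; apply/rowP => i; rewrite !mxE.
move/rowP: e => /(_ i); rewrite !mxE addSn exprS -!mulrA => e.
by apply/eqP; rewrite eq_le !floor_half.
Qed.

(** A pair [(l, q)] stands for the half-open dyadic cube of side 2^-l labelled [q]. *)
Definition net_cost (R : realType) (n : nat) (a : R)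
    (C : set (nat * 'rV[int]_n)) : \bar R :=
  (\esum_(Q in C) (a ^+ Q.1)%:E)%E.

Definition net_cover (R : realType) (n : nat) (A : set 'rV[R]_n)
    (C : set (nat * 'rV[int]_n)) : Prop :=
  forall x, A x -> exists l, C (l, cell l x).

(* With a = 2^-s this is the dyadic s-dimensional Hausdorff content, for cubes
   of side at most 1. *)
Definition net_content (R : realType) (n : nat) (a : R) (A : set 'rV[R]_n) :
    \bar R :=
  ereal_inf [set net_cost a C | C in net_cover A].

Lemma net_cost_ge0 (R : realType) (n : nat) (a : R)
  (C : set (nat * 'rV[int]_n)) : 0 <= a -> (0 <= net_cost a C)%E.
Proof. by move=> a0; apply: esum_ge0 => Q _; rewrite lee_fin exprn_ge0. Qed.

Lemma le_net_cost (R : realType) (n : nat) (a : R)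
  (C D : set (nat * 'rV[int]_n)) :
  0 <= a -> C `<=` D -> (net_cost a C <= net_cost a D)%E.
Proof.
move=> a0 CD; rewrite /net_cost [leLHS]esum_mkcond [leRHS]esum_mkcond.
apply: le_esum => Q _ /=; case: ifPn => [/set_mem/CD/mem_set -> //|_].
by case: ifP => _ //; rewrite lee_fin exprn_ge0.
Qed.

Lemma net_content_ge0 (R : realType) (n : nat) (a : R) (A : set 'rV[R]_n) :
  0 <= a -> (0 <= net_content a A)%E.
Proof.
by move=> a0; apply: le_ereal_inf_tmp => _ [C _ <-]; apply: net_cost_ge0.
Qed.

Lemma net_content_le (R : realType) (n : nat) (a : R) (A : set 'rV[R]_n) C :
  net_cover A C -> (net_content a A <= net_cost a C)%E.
Proof. by move=> AC; apply: ereal_inf_lbound; exists C. Qed.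

Lemma le_net_content (R : realType) (n : nat) (a : R) (A B : set 'rV[R]_n) :
  A `<=` B -> (net_content a A <= net_content a B)%E.
Proof.
move=> AB; apply: le_ereal_inf_tmp => _ [C BC <-]; apply: net_content_le => x Ax.
exact: BC (AB _ Ax).
Qed.

Lemma net_content_set0 (R : realType) (n : nat) (a : R) :
  0 <= a -> net_content a (@set0 'rV[R]_n) = 0%E.
Proof.
move=> a0; apply/eqP; rewrite eq_le net_content_ge0 // andbT.
apply: le_trans (@net_content_le _ _ a _ set0 _) _; first by move=> x [].
by rewrite /net_cost esum_set0.
Qed.

Lemma net_content_mono (R : realType) (n : nat) (a b : R) (A : set 'rV[R]_n) :
  0 <= a -> a <= b -> (net_content a A <= net_content b A)%E.
Proof.
move=> a0 ab; apply: le_ereal_inf_tmp => _ [C AC <-].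
apply: le_trans (net_content_le a AC) _; apply: le_esum => Q _.
by rewrite lee_fin lerXn2r // nnegrE // (le_trans a0).
Qed.

(** The cubes of [C] lying in no strictly larger cube of [C]. By [cell_nested] all points of a cube
    share its ancestors, so the test gives the same answer at each of them. *)
Definition net_max (R : realType) (n : nat) (C : set (nat * 'rV[int]_n)) :
    set (nat * 'rV[int]_n) :=
  [set Q | C Q /\ forall x : 'rV[R]_n, cell Q.1 x = Q.2 ->
     forall l, (l < Q.1)%N -> ~ C (l, cell l x)].

Lemma net_max_cover (R : realType) (n : nat) (A : set 'rV[R]_n) C :
  net_cover A C -> net_cover A (net_max R C).
Proof.
move=> AC x /AC [l Cl].
have ex : exists l, `[< C (l, cell l x) >] by exists l; apply/asboolP.
case: (ex_minnP ex) => m /asboolP Cm mmin; exists m; split=> //= y ey k km Ck.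
have := mmin k; rewrite -(cell_nested (ltnW km) ey) => /(_ (asboolT Ck)).
by rewrite leqNgt km.
Qed.

(** The cubes of [C] that lie in some cube of [D], equality included. *)
Definition net_meet (R : realType) (n : nat) (C D : set (nat * 'rV[int]_n)) :
    set (nat * 'rV[int]_n) :=
  [set Q | C Q /\ exists x : 'rV[R]_n, cell Q.1 x = Q.2 /\
     exists2 l, (l <= Q.1)%N & D (l, cell l x)].

(* Of two dyadic cubes that meet, one contains the other; so the maximal cubes
   of two covers, together with the cubes of each that lie in a cube of the
   other, use no cube more often than the two covers do. *)
Lemma net_cost_strong_subadd (R : realType) (n : nat) (a : R)
  (A B : set 'rV[R]_n) C D :
  0 <= a -> net_cover A C -> net_cover B D ->
  (net_cost a (net_max R (C `|` D)) + net_content a (A `&` B) <=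
   net_cost a (net_max R C) + net_cost a D)%E.
Proof.
move=> a0 AC BD; pose U := net_max R C.
have AU : net_cover A U by apply: net_max_cover.
pose I := net_meet R U D `|` net_meet R D U.
have IAB : net_cover (A `&` B) I.
  move=> x [/AU[l Ul] /BD[k Dk]]; case: (leqP k l) => kl.
    by exists l; left; split=> //=; exists x; split=> //; exists k.
  by exists k; right; split=> //=; exists x; split=> //; exists l => //; apply: ltnW.
apply: le_trans (leeD (lexx _) (net_content_le a IAB)) _.
rewrite /net_cost !(esum_mkcond (net_max _ _)) (esum_mkcond I) (esum_mkcond D).
have w0 (S : set (nat * 'rV[int]_n)) (Q : nat * 'rV[int]_n) :
    (0 <= if Q \in S then (a ^+ Q.1)%:E else 0)%E.
  by case: ifP => _ //; rewrite lee_fin exprn_ge0.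
rewrite -esumD // -esumD //; apply: le_esum => Q _ /=.
have aQ : 0 <= a ^+ Q.1 by rewrite exprn_ge0.
have tie (S : set (nat * 'rV[int]_n)) : S Q -> (Q \in S) = true by move/mem_set.
have maxU : net_max R (C `|` D) Q -> D Q \/ U Q.
  move=> [[CQ|DQ] h]; last by left.
  by right; split=> // x ex l lQ Cl; apply: h ex _ lQ _; left.
have IU : I Q -> D Q \/ U Q by case=> [[UQ _]|[DQ _]]; [right|left].
(* A cube counted twice on the left is counted twice on the right: a strictly larger cube of the
   other cover would contradict maximality. *)
have both : net_max R (C `|` D) Q -> I Q -> U Q /\ D Q.
  move=> mQ; case=> [[UQ [x [ex [l lQ Dl]]]]|[DQ [x [ex [l lQ Ul]]]]].
    split=> //; move: lQ; rewrite leq_eqVlt => /orP[/eqP lQ|lQ].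
      by move: Dl; rewrite lQ ex -surjective_pairing.
    by case: mQ => _ /(_ x ex _ lQ); case; right.
  split=> //; move: lQ; rewrite leq_eqVlt => /orP[/eqP lQ|lQ].
    by move: Ul; rewrite lQ ex -surjective_pairing.
  by case: mQ => _ /(_ x ex _ lQ); case; left; case: Ul.
case: (boolP (Q \in net_max _ _)) => [/set_mem mQ|_];
  case: (boolP (Q \in I)) => [/set_mem iQ|_].
- by have [/tie -> /tie ->] := both mQ iQ.
- rewrite adde0; case: (maxU mQ) => /tie ->; last by rewrite leeDl.
  by rewrite leeDr.
- rewrite add0e; case: (IU iQ) => /tie ->; last by rewrite leeDl.
  by rewrite leeDr.
- by rewrite adde0 adde_ge0.
Qed.

Lemma net_content_near (R : realType) (n : nat) (a e : R) (A : set 'rV[R]_n) :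
  0 <= a -> 0 < e -> (net_content a A < +oo)%E ->
  exists2 C, net_cover A C & (net_cost a C <= net_content a A + e%:E)%E.
Proof.
move=> a0 e0 Aoo.
have Afin : net_content a A \is a fin_num by rewrite ge0_fin_numE // net_content_ge0.
have [_ [C AC <-] lt] := lb_ereal_inf_adherent e0 Afin.
by exists C => //; apply: ltW.
Qed.

(** Near-optimal covers [C k] of [A k], with errors e/2^(k+1), are merged one at a time. Since [A k]
    is contained in [A k.+1], strong subadditivity lets only the errors accumulate, so the maximal
    cubes of the merged cover [U k] cost at most r + e. *)
Lemma net_content_bigcup_nondecreasing (R : realType) (n : nat) (a : R)
  (A : nat -> set 'rV[R]_n) (r : \bar R) :
  0 <= a -> (forall k, A k `<=` A k.+1) ->
  (forall k, (net_content a (A k) <= r)%E) ->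
  (net_content a (\bigcup_k A k) <= r)%E.
Proof.
move=> a0 Ainc Ar.
have [->|roo] := eqVneq r +oo%E; first exact: leey.
have Aoo k : (net_content a (A k) < +oo)%E.
  by apply: le_lt_trans (Ar k) _; rewrite ltey.
have Afin k : net_content a (A k) \is a fin_num.
  by rewrite ge0_fin_numE ?net_content_ge0.
apply/lee_addgt0Pr => e e0.
pose eps k : R := e * 2^-1 ^+ k.+1.
(* [p k] is the sum of [eps 0] to [eps k]. *)
pose p k : R := e * (1 - 2^-1 ^+ k.+1).
have eps0 k : 0 < eps k by rewrite mulr_gt0 // exprn_gt0.
have pS k : p k.+1 = p k + eps k.+1 by rewrite /p /eps !exprS; field.
have /choice[C /all_and2[AC costC]] : forall k, exists C, net_cover (A k) C /\
    (net_cost a C <= net_content a (A k) + (eps k)%:E)%E.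
  by move=> k; have [C ? ?] := net_content_near a0 (eps0 k) (Aoo k); exists C.
pose U k := \bigcup_(i in [set i | (i <= k)%N]) C i.
have US k : U k.+1 = U k `|` C k.+1.
  apply/seteqP; split=> Q.
    move=> [i /= ik CQ]; move: ik; rewrite leq_eqVlt => /orP[/eqP <-|ik].
      by right.
    by left; exists i.
  by case=> [[i /= ik CQ]|CQ]; [exists i => //=; apply: leqW|exists k.+1 => /=].
have AU k : net_cover (A k) (U k).
  by move=> x /AC [l Cl]; exists l, k => /=.
have costU k : (net_cost a (net_max R (U k)) <= net_content a (A k) + (p k)%:E)%E.
  elim: k => [|k IH].
    have -> : p 0%N = eps 0%N by rewrite /p /eps expr1; field.
    apply: le_trans (costC 0%N).
    have -> : C 0%N = U 0%N.
      by apply/seteqP; split=> [Q CQ|Q [i /=]]; [exists 0%N|rewrite leqn0 => /eqP ->].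
    by apply: le_net_cost => // Q [].
  have := net_cost_strong_subadd a0 (AU k) (AC k.+1).
  rewrite -US (setIidl (Ainc k)) => sub.
  (* The finite content of [A k] is added to both sides; it cancels the one in the induction
     hypothesis. *)
  rewrite -(leeD2rE _ _ (Afin k)); apply: le_trans sub _.
  apply: le_trans (leeD IH (costC k.+1)) _.
  rewrite -(fineK (Afin k)) -(fineK (Afin k.+1)) -!EFinD lee_fin pS; lra.
pose V := \bigcup_i C i.
have VA : net_cover (\bigcup_k A k) V.
  by move=> x [k _ /AC[l Cl]]; exists l, k.
apply: le_trans (net_content_le a (net_max_cover VA)) _.
apply: ge_ereal_sup => _ [F [finF FM] <-].
(* The infinite sum is a supremum over finite sets of cubes. Such an [F] lies in one [U k], and
   cubes maximal in [V] are maximal in [U k]. *)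
have [k Fk] : exists k, F `<=` U k.
  have /finite_seqP[t Ft] := finF.
  have : forall Q, Q \in t -> V Q.
    by move=> Q Qt; have /FM[] : F Q by rewrite Ft.
  rewrite Ft; elim: t {finF FM Ft} => [|Q t IH] tV; first by exists 0%N.
  have [|k tk] := IH; first by move=> Q' Q't; apply: tV; rewrite inE Q't orbT.
  have [i _ CQ] := tV Q (mem_head _ _); exists (maxn i k) => Q'.
  rewrite /= inE => /orP[/eqP ->|/tk [m /= mk CQ']].
    by exists i => //=; rewrite leq_maxl.
  by exists m => //=; rewrite (leq_trans mk) // leq_maxr.
have : (\sum_(Q \in F) (a ^+ Q.1)%:E <= net_cost a (net_max R (U k)))%E.
  apply: esum_ge; exists F => //; split=> // Q FQ; split; first exact: Fk.
  move=> x ex l lQ [i /= _ CQ]; have [_ /(_ x ex l lQ)] := FM _ FQ; apply.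
  by exists i.
move=> /le_trans; apply; apply: le_trans (costU k) _; apply: leeD (Ar k) _.
by rewrite lee_fin ler_piMr ?ltW // gerBl exprn_ge0.
Qed.

Lemma net_contentU (R : realType) (n : nat) (a : R) (A B : set 'rV[R]_n) :
  0 <= a -> (net_content a (A `|` B) <= net_content a A + net_content a B)%E.
Proof.
move=> a0; have [A0 B0] := (net_content_ge0 A a0, net_content_ge0 B a0).
have [Aoo|] := ltP (net_content a A) +oo%E; last first.
  by rewrite leye_eq => /eqP ->; rewrite addye ?leey // gt_eqF // (lt_le_trans _ B0) ?ltNyr.
have [Boo|] := ltP (net_content a B) +oo%E; last first.
  by rewrite leye_eq => /eqP ->; rewrite addey ?leey // gt_eqF // (lt_le_trans _ A0) ?ltNyr.
apply/lee_addgt0Pr => e e0; have e2 : 0 < e / 2 by rewrite divr_gt0.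
have [C AC costC] := net_content_near a0 e2 Aoo.
have [D BD costD] := net_content_near a0 e2 Boo.
have AUB : net_cover (A `|` B) (C `|` D).
  by move=> x [/AC[l ?]|/BD[l ?]]; exists l; [left|right].
apply: le_trans (net_content_le a (net_max_cover AUB)) _.
apply: le_trans (leeDl _ (net_content_ge0 (A `&` B) a0)) _.
apply: le_trans (net_cost_strong_subadd a0 AC BD) _.
have CC : (net_cost a (net_max R C) <= net_cost a C)%E.
  by apply: le_net_cost => // Q [].
apply: le_trans (leeD (le_trans CC costC) costD) _.
by rewrite addeACA -EFinD -splitr.
Qed.

Lemma net_content_bigcup0 (R : realType) (n : nat) (a : R)
  (A : nat -> set 'rV[R]_n) :
  0 <= a -> (forall k, net_content a (A k) = 0%E) ->
  net_content a (\bigcup_k A k) = 0%E.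
Proof.
move=> a0 A0; apply/eqP; rewrite eq_le net_content_ge0 // andbT.
pose B k := \bigcup_(i in [set i | (i <= k)%N]) A i.
have -> : \bigcup_k A k = \bigcup_k B k.
  apply/seteqP; split=> x [k _]; first by exists k => //; exists k => /=.
  by move=> [i _ Ai]; exists i.
apply: net_content_bigcup_nondecreasing => // [k x [i /= ik Ai]|k].
  by exists i => //=; apply: leqW.
elim: k => [|k IH].
  rewrite -(A0 0%N); apply: le_net_content => x [i /=].
  by rewrite leqn0 => /eqP ->.
have BS : B k.+1 `<=` B k `|` A k.+1.
  move=> x [i /=]; rewrite leq_eqVlt => /orP[/eqP <-|ik] Ai; first by right.
  by left; exists i.
apply: le_trans (le_net_content _ BS) _; apply: le_trans (net_contentU _ _ a0) _.
by rewrite A0 adde0.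
Qed.

(** * Finite Frostman measures *)

(** A finitely supported measure is a list of weighted points, possibly with repetitions. *)
Definition mass (R : realType) (n : nat) (s : seq ('rV[R]_n * R))
    (P : pred 'rV[R]_n) : R :=
  \sum_(u <- s | P u.1) u.2.

(** With a = 2^-u this is the growth condition mu(Q) <= side(Q)^u, with constant 1, for dyadic cubes
    of side 1 down to 2^-J. *)
Definition frostman (R : realType) (n : nat) (a : R) (J : nat)
    (s : seq ('rV[R]_n * R)) : Prop :=
  (forall u, u \in s -> 0 <= u.2) /\
  forall l k, (l <= J)%N -> mass s (fun y => cell l y == k) <= a ^+ l.

Lemma ler_mass (R : realType) (n : nat) (s : seq ('rV[R]_n * R))
  (P Q : pred 'rV[R]_n) :
  (forall u, u \in s -> 0 <= u.2) ->
  (forall u, u \in s -> P u.1 -> Q u.1) -> mass s P <= mass s Q.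
Proof.
move=> s0 PQ; rewrite /mass [leLHS]big_mkcond [leRHS]big_mkcond.
rewrite big_seq [leRHS]big_seq; apply: ler_sum => u us.
by case: ifPn => [/(PQ _ us) ->|_] //; case: ifP => _ //; apply: s0.
Qed.

Lemma mass_ge0 (R : realType) (n : nat) (s : seq ('rV[R]_n * R))
  (P : pred 'rV[R]_n) :
  (forall u, u \in s -> 0 <= u.2) -> 0 <= mass s P.
Proof.
by move=> s0; rewrite /mass big_seq_cond sumr_ge0 // => u /andP[/s0].
Qed.

Lemma mass_has (R : realType) (n : nat) (s : seq ('rV[R]_n * R)) (T : eqType)
  (r : seq T) (P : pred 'rV[R]_n) (Q : T -> pred 'rV[R]_n) :
  (forall u, u \in s -> 0 <= u.2) ->
  (forall u, u \in s -> P u.1 -> has (fun t => Q t u.1) r) ->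
  mass s P <= \sum_(t <- r) mass s (Q t).
Proof.
move=> s0 PQ; rewrite /mass.
under [leRHS]eq_bigr do rewrite big_mkcond.
rewrite exchange_big /= [leLHS]big_mkcond big_seq [leRHS]big_seq.
apply: ler_sum => u us; have u0 := s0 _ us.
have S0 (r' : seq T) : 0 <= \sum_(t <- r') (if Q t u.1 then u.2 else 0).
  by apply: sumr_ge0 => t _; case: ifP.
case: ifPn => [/(PQ _ us) /hasP[t tr Qt]|_]; last exact: S0.
by rewrite (perm_big _ (perm_to_rem tr)) big_cons Qt lerDl S0.
Qed.

(* The points receive in turn the largest weight that the constraints allow, so
   that each of them ends up in a saturated cell. *)
Lemma frostman_greedy (R : realType) (n : nat) (a : R) (J : nat)
  (X : seq 'rV[R]_n) :
  0 < a -> exists2 s : seq ('rV[R]_n * R), map fst s = X &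
    frostman a J s /\ forall x, x \in X -> exists2 l, (l <= J)%N &
      mass s (fun y => cell l y == cell l x) = a ^+ l.
Proof.
move=> a0; elim: X => [|x X [s sX [[s0 sle] sat]]].
  exists [::] => //; split=> //; split=> // l k _.
  by rewrite /mass big_nil exprn_ge0 // ltW.
pose F (l : 'I_J.+1) := a ^+ l - mass s (fun y => cell l y == cell l x).
have [l0 _ lmin] := Order.TotalTheory.arg_minP F (erefl true : predT (@ord0 J)).
have F0 l : 0 <= F l by rewrite subr_ge0 sle // -ltnS ltn_ord.
pose s' := (x, F l0) :: s.
have s'0 u : u \in s' -> 0 <= u.2.
  by rewrite inE => /orP[/eqP -> /=|/s0].
have s'le l k : (l <= J)%N -> mass s' (fun y => cell l y == k) <= a ^+ l.
  move=> lJ; rewrite /mass big_cons /=; case: ifPn => [/eqP <-|_]; last exact: sle.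
  by rewrite -lerBrDr; exact: lmin (Ordinal (lJ : (l < J.+1)%N)) erefl.
exists s'; first by rewrite /= sX.
split=> // y; rewrite inE => /orP[/eqP ->|/sat [l lJ e]].
  exists (l0 : nat); first by rewrite -ltnS ltn_ord.
  by rewrite /mass big_cons /= eqxx /F subrK.
exists l => //; apply/eqP; rewrite eq_le s'le //= -e /mass big_cons /=.
by case: ifP => _ //; rewrite lerDr F0.
Qed.

(** A cube has 2^n children, whose labels are 2q or 2q + 1 in each coordinate. *)
Lemma finite_cells (R : realType) (n J : nat) (A : set 'rV[R]_n) k :
  A `<=` [set x | cell 0 x = k] -> finite_set (cell J @` A).
Proof.
move=> Ak; elim: J => [|J IH].
  by apply: (@sub_finite_set _ _ [set k]) => // _ [x /Ak /= -> <-].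
pose F (q : 'rV[int]_n) (e : {ffun 'I_n -> bool}) : 'rV[int]_n :=
  \row_i (2 * q 0 i + (e i)%:Z).
have fin : finite_set [set F q e | q in cell J @` A & e in [set: {ffun 'I_n -> bool}]].
  by apply: finite_image2.
apply: sub_finite_set fin => _ [x Ax <-].
exists (cell J x); first by exists x.
exists [ffun i => (cell J.+1 x 0 i != 2 * cell J x 0 i)] => //.
apply/rowP => i; rewrite !mxE ffunE !mxE exprS -mulrA.
set v := 2 ^+ J * x 0 i.
have /andP[] := floor_itv v; set m := Num.floor v => m1 m2.
rewrite intrD in m2.
have : (2 * m <= Num.floor (2 * v))%R by rewrite floor_ge_int intrM ler_pM2l.
have : (Num.floor (2 * v) < 2 * m + 2)%R.
  by rewrite floor_lt_int intrD intrM; lra.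
by case: eqP => /= [->|] *; lia.
Qed.

(** Frostman's lemma at resolution 2^-J. One point of [A] is taken from each cell of level [J] that
    [A] meets, and [frostman_greedy] weights these points. *)
Lemma frostman_exists (R : realType) (n : nat) (a : R) (J : nat)
  (A : set 'rV[R]_n) k :
  0 < a -> A `<=` [set x | cell 0 x = k] ->
  exists s : seq ('rV[R]_n * R), [/\ frostman a J s,
    forall u, u \in s -> A u.1 & (net_content a A <= (mass s predT)%:E)%E].
Proof.
move=> a0 Ak.
have [t tE] := (finite_seqP _).1 (finite_cells J Ak).
have [X [XA XJ]] : exists X : seq 'rV[R]_n, (forall x, x \in X -> A x) /\
    forall y, A y -> exists2 x, x \in X & cell J x = cell J y.
  have : forall q, q \in t -> (cell J @` A) q by rewrite tE.
  have : forall y, A y -> cell J y \in t.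
    by move=> y Ay; have : (cell J @` A) (cell J y) by [exists y]; rewrite tE.
  elim: t A {Ak tE} => [|q t IH] A At tA.
    by exists [::]; split=> // y /At.
  have [w [] //|q' q't|z [XA XJ]] := IH (A `&` [set y | cell J y \in t]).
  - have [|x Ax e] := tA q'; first by rewrite inE q't orbT.
    by exists x => //; split=> //=; rewrite e.
  - have [x Ax e] := tA q (mem_head _ _).
    exists (x :: z); split=> [y|y Ay].
      by rewrite inE => /orP[/eqP ->|/XA[]].
    have := At _ Ay; rewrite inE => /orP[/eqP ->|yt].
      by exists x => //; exact: mem_head.
    have [|w wz ew] := XJ y; first by split.
    by exists w => //; rewrite inE wz orbT.
have [s sX [fr sat]] := @frostman_greedy R n a J X a0.
have s0 := fr.1.
exists s; split=> //.
  by move=> u us; apply: XA; rewrite -sX map_f.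
(* The largest saturated cells are disjoint and cover A, so the content of A is
   at most the sum of their masses. *)
pose full l (x : 'rV[R]_n) := mass s (fun y => cell l y == cell l x) == a ^+ l.
pose M := undup [seq Q <- [seq (l, cell l x) | l <- iota 0 J.+1, x <- X] |
  (mass s (fun y => cell Q.1 y == Q.2) == a ^+ Q.1) &&
  all (fun l => all (fun x => (cell Q.1 x == Q.2) ==> ~~ full l x) X) (iota 0 Q.1)].
have MP Q : Q \in M -> mass s (fun y => cell Q.1 y == Q.2) = a ^+ Q.1 /\
    forall x l, x \in X -> cell Q.1 x = Q.2 -> (l < Q.1)%N -> ~~ full l x.
  rewrite mem_undup mem_filter => /andP[/andP[/eqP e /allP h] _]; split=> // x l xX ex lQ.
  have /allP : all (fun x => (cell Q.1 x == Q.2) ==> ~~ full l x) X.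
    by apply: h; rewrite mem_iota.
  by move=> /(_ x xX); rewrite ex eqxx implyTb.
have cover : net_cover A [set` M].
  move=> y /XJ [x xX exy].
  have ex : exists l, full l x by have [l _ e] := sat x xX; exists l; apply/eqP.
  case: (ex_minnP ex) => l fl lmin.
  have lJ : (l <= J)%N.
    have [m mJ e] := sat x xX; apply: leq_trans mJ; apply: lmin; exact/eqP.
  exists l; rewrite /= -(cell_nested lJ exy) mem_undup mem_filter.
  apply/andP; split; last by apply: allpairs_f; rewrite ?mem_iota.
  apply/andP; split; first exact: fl.
  apply/allP => m; rewrite mem_iota /= add0n => ml.
  apply/allP => z zX; apply/implyP => /eqP ez.
  rewrite /full (cell_nested (ltnW ml) ez); apply: contraL ml => fm.
  by rewrite -leqNgt lmin.
apply: le_trans (net_content_le a cover) _.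
rewrite /net_cost esum_fset; last 2 first.
  exact: finite_seq.
  by move=> Q _; rewrite lee_fin exprn_ge0 // ltW.
rewrite -fsbig_seq ?undup_uniq // sumEFin lee_fin.
rewrite (eq_big_seq (fun Q => mass s (fun y => cell Q.1 y == Q.2))); last first.
  by move=> Q /MP[->].
rewrite /mass; under eq_bigr do rewrite big_mkcond.
(* Each weighted point counts at most once: of two cubes of [M] through it, the smaller would lie in
   a larger saturated one, against the choice of [M]. *)
rewrite exchange_big /= big_seq [leRHS]big_seq; apply: ler_sum => u us.
rewrite -big_mkcond /=.
have uX : u.1 \in X by rewrite -sX map_f.
case: (boolP (has (fun Q => cell Q.1 u.1 == Q.2) M)) => [/hasP[Q QM /eqP eQ]|/hasPn h].
  have only Q' : Q' \in M -> (cell Q'.1 u.1 == Q'.2) = (Q' == Q).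
    move=> Q'M; apply/eqP/eqP => [eQ'|->//].
    have [[fQ hQ] [fQ' hQ']] := (MP _ QM, MP _ Q'M).
    have e1 : Q'.1 = Q.1.
      apply/eqP; case: ltngtP => // lt.
        by have := hQ _ _ uX eQ lt; rewrite /full eQ' fQ' eqxx.
      by have := hQ' _ _ uX eQ' lt; rewrite /full eQ fQ eqxx.
    by rewrite (surjective_pairing Q') (surjective_pairing Q) -eQ -eQ' e1.
  rewrite big_seq_cond (eq_bigl (fun Q' => (Q' \in M) && (Q' == Q))); last first.
    by move=> Q'; case: (boolP (Q' \in M)) => //= /only ->.
  rewrite -big_seq_cond -big_filter filter_pred1_uniq ?undup_uniq //.
  by rewrite big_seq1.
rewrite big_hasC; first exact: s0.
by apply/hasPn => Q /h.
Qed.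

(** * Energy of projections *)

Lemma edotC (R : realType) (n : nat) (u v : 'rV[R]_n) : edot u v = edot v u.
Proof. by apply: eq_bigr => i _; rewrite mulrC. Qed.

Lemma edotDl (R : realType) (n : nat) (u v w : 'rV[R]_n) :
  edot (u + v) w = edot u w + edot v w.
Proof. by rewrite -big_split; apply: eq_bigr => i _; rewrite mxE mulrDl. Qed.

Lemma edotZl (R : realType) (n : nat) c (u w : 'rV[R]_n) :
  edot (c *: u) w = c * edot u w.
Proof. by rewrite mulr_sumr; apply: eq_bigr => i _; rewrite mxE mulrA. Qed.

Lemma edotNl (R : realType) (n : nat) (u w : 'rV[R]_n) :
  edot (- u) w = - edot u w.
Proof. by rewrite -scaleN1r edotZl mulN1r. Qed.

Lemma edot_ge_sqr (R : realType) (n : nat) (u : 'rV[R]_n) i :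
  u 0 i ^+ 2 <= edot u u.
Proof.
rewrite /edot (bigD1 i) //= -expr2 lerDl; apply: sumr_ge0 => k _.
by rewrite -expr2 sqr_ge0.
Qed.

Lemma edot_ge0 (R : realType) (n : nat) (u : 'rV[R]_n) : 0 <= edot u u.
Proof. by apply: sumr_ge0 => k _; rewrite -expr2 sqr_ge0. Qed.

Lemma sqr_enorm (R : realType) (n : nat) (u : 'rV[R]_n) :
  enorm u ^+ 2 = edot u u.
Proof. by rewrite sqr_sqrtr // edot_ge0. Qed.

Lemma enorm_ge0 (R : realType) (n : nat) (u : 'rV[R]_n) : 0 <= enorm u.
Proof. exact: sqrtr_ge0. Qed.

Lemma ler_enorm_coord (R : realType) (n : nat) (u : 'rV[R]_n) i :
  `|u 0 i| <= enorm u.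
Proof. by rewrite -ler_sqr ?nnegrE ?enorm_ge0 // sqr_enorm real_normK ?num_real // edot_ge_sqr. Qed.

(** For a unit vector [x], the orthogonal projection onto the hyperplane orthogonal to [x];
    [orthproj_tangent_sphere] identifies it with the matrix projection. *)
Definition sproj (R : realType) (n : nat) (x v : 'rV[R]_n) : 'rV[R]_n :=
  v - edot v x *: x.

Lemma sqr_enorm_sproj (R : realType) (n : nat) (x v : 'rV[R]_n) :
  enorm x = 1 -> enorm (sproj x v) ^+ 2 = edot v v - edot v x ^+ 2.
Proof.
move=> x1; have xx : edot x x = 1 by rewrite -sqr_enorm x1 expr1n.
rewrite sqr_enorm /sproj edotDl edotNl edotZl ![edot _ (v - _)]edotC.
rewrite !edotDl !edotNl !edotZl xx (edotC x v); ring.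
Qed.

(** With e = v/|v| and q = <e,x>, the projection has squared norm |v|^2 (1 - q^2), which forces q^2
    >= 1 - (r/d)^2; so [x] is close to e or -e according to the sign of q. The same [e] serves for
    all [x]. *)
Lemma sproj_small (R : realType) (n : nat) (v : 'rV[R]_n) (i0 : 'I_n) (r d : R) :
  0 < d -> d < `|v 0 i0| -> exists e : 'rV[R]_n, forall x, enorm x = 1 ->
    enorm (sproj x v) < r ->
    (forall i, `|x 0 i - e 0 i| <= 2 * r / d) \/
    (forall i, `|x 0 i - (- e) 0 i| <= 2 * r / d).
Proof.
move=> d0 dv; have dV := lt_le_trans dv (ler_enorm_coord v i0).
have V0 : 0 < enorm v by apply: lt_trans dV.
exists ((enorm v)^-1 *: v) => x x1 xr; set e := _ *: v.
have r0 : 0 < r by apply: le_lt_trans xr; rewrite enorm_ge0.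
have ee : edot e e = 1.
  rewrite /e edotZl edotC edotZl -sqr_enorm; field; exact: lt0r_neq0.
have xx : edot x x = 1 by rewrite -sqr_enorm x1 expr1n.
pose q := edot e x.
have q2 : 1 - (r / d) ^+ 2 <= q ^+ 2.
  have : enorm (sproj x v) ^+ 2 < r ^+ 2 by rewrite ltr_pXn2r ?nnegrE ?enorm_ge0 // ltW.
  rewrite sqr_enorm_sproj // -sqr_enorm => h.
  rewrite /q /e edotZl [in leRHS]exprMn.
  have V20 : 0 < enorm v ^+ 2 by rewrite exprn_gt0.
  rewrite -(@ler_pM2r _ (enorm v ^+ 2)) //.
  have -> : (enorm v)^-1 ^+ 2 * edot v x ^+ 2 * enorm v ^+ 2 = edot v x ^+ 2.
    by field; exact: lt0r_neq0.
  have : r ^+ 2 <= (r / d) ^+ 2 * enorm v ^+ 2.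
    have rv : r <= r / d * enorm v by rewrite mulrAC ler_pdivlMr // ler_pM2l // ltW.
    by rewrite -exprMn ler_sqr // nnegrE ltW // (lt_le_trans r0).
  by rewrite mulrBl mul1r; lra.
have rd0 : 0 <= r / d by rewrite divr_ge0 // ltW.
have close (f : 'rV[R]_n) : edot f f = 1 -> 0 <= edot f x ->
    edot f x ^+ 2 = q ^+ 2 -> forall i, `|x 0 i - f 0 i| <= 2 * r / d.
  move=> ff fx0 fxq i.
  have -> : x 0 i - f 0 i = (x - f) 0 i by rewrite !mxE.
  rewrite -ler_sqr ?nnegrE //; last by rewrite -mulrA mulr_ge0.
  rewrite real_normK ?num_real //; apply: le_trans (edot_ge_sqr _ _) _.
  rewrite edotDl edotNl ![edot _ (x - _)]edotC !edotDl !edotNl xx ff (edotC x f).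
  move: q2 fx0; rewrite -fxq -mulrA; set t := edot f x; set w := r / d => q2 t0.
  (* The squared distance is 2 - 2t: nonpositive when t >= 1, and at most 2(1 - t^2) <= 2w^2 when 0
     <= t < 1. *)
  have w2 := sqr_ge0 w; have [t1|t1] := leP 1 t; first by nra.
  have : 0 <= t * (1 - t) by rewrite mulr_ge0 // subr_ge0 ltW.
  nra.
have [q0|q0] := leP 0 q; [left|right]; apply: close => //.
- by rewrite edotNl edotC edotNl opprK.
- by rewrite edotNl oppr_ge0 ltW.
- by rewrite edotNl sqrrN.
Qed.

Definition near_box (R : realType) (n : nat) (r : R) (y : 'rV[R]_n) :
    pred 'rV[R]_n :=
  fun z => [forall i, `|z 0 i - y 0 i| <= r].

Lemma frostman_box (R : realType) (n : nat) (a : R) (J l C : nat)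
  (s : seq ('rV[R]_n * R)) (y : 'rV[R]_n) :
  frostman a J s -> (l <= J)%N ->
  mass s (near_box (C%:R / 2 ^+ l) y) <= ((2 * C).+1 ^ n)%:R * a ^+ l.
Proof.
move=> [s0 sle] lJ.
(* The value [e i] in 0..2C encodes a difference of labels in -C..C. *)
pose q (e : {ffun 'I_n -> 'I_(2 * C).+1}) : 'rV[int]_n :=
  \row_i (cell l y 0 i + (e i : nat)%:Z - C%:Z).
apply: le_trans (@mass_has _ _ s _ (enum {: {ffun 'I_n -> 'I_(2 * C).+1}}) _
  (fun e z => cell l z == q e) s0 _) _; last first.
  apply: le_trans (ler_sum _ (fun e _ => sle l (q e) lJ)) _.
  by rewrite big_const_seq count_predT iter_addr addr0 -cardE card_ffun !card_ord mulr_natl.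
move=> u us /forallP near; apply/hasP.
have diff i : (`|cell l u.1 0 i - cell l y 0 i| <= C%:Z)%R.
  rewrite !mxE; set b := 2 ^+ l * u.1 0 i; set c := 2 ^+ l * y 0 i.
  have l2 : 0 < 2 ^+ l :> R by rewrite exprn_gt0.
  have : `|b - c| <= C%:R.
    by rewrite /b /c -mulrBr normrM gtr0_norm // mulrC -ler_pdivlMr // near.
  have [/andP[b1 b2] /andP[c1 c2]] := (floor_itv b, floor_itv c).
  rewrite ler_norml => /andP[h1 h2]; rewrite !intrD in b2 c2.
  have : (Num.floor b - Num.floor c < C%:Z + 1)%R.
    by rewrite -(ltr_int R) rmorphB intrD /=; lra.
  have : (Num.floor c - Num.floor b < C%:Z + 1)%R.
    by rewrite -(ltr_int R) rmorphB intrD /=; lra.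
  lia.
pose e : {ffun 'I_n -> 'I_(2 * C).+1} :=
  [ffun i => inord (absz (cell l u.1 0 i - cell l y 0 i + C%:Z)%R)].
exists e; first by rewrite mem_enum.
apply/eqP/rowP => i; rewrite [RHS]mxE ffunE.
move: (cell l u.1 0 i) (cell l y 0 i) (diff i) => b c bc.
by rewrite inordK; lia.
Qed.

(** The mu x mu measure of the pairs of points whose projections along [x] are less than [r]
    apart. *)
Definition tube_energy (R : realType) (n : nat) (s : seq ('rV[R]_n * R)) (r : R)
    (x : 'rV[R]_n) : R :=
  \sum_(p <- s) p.2 * mass s (fun z => enorm (sproj x (z - p.1)) < r).

(* A box of radius m times the side of a cell meets at most (2m+1)^n cells of
   that size. Two antipodal boxes with m = 8 contain the directions in which a
   given pair of points is seen as close, a box with m = 1 the points at a given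
   distance; the last factor sums the geometric series over these distances. *)
Definition energy_const (R : realType) (n : nat) (a g : R) : R :=
  2 * (17 ^ n)%:R * (3 ^ n)%:R / (1 - g / a).

Lemma frostman_total (R : realType) (n : nat) (a : R) (J : nat)
  (s : seq ('rV[R]_n * R)) k (P : pred 'rV[R]_n) :
  frostman a J s -> (forall u, u \in s -> cell 0 u.1 = k) -> mass s P <= 1.
Proof.
move=> [s0 sle] sk; rewrite -(expr0 a).
apply: le_trans (sle 0%N k (leq0n _)); apply: ler_mass => // u /sk -> _.
exact: eqxx.
Qed.

Lemma near_unit_cell (R : realType) (n : nat) (y z : 'rV[R]_n) :
  cell 0 y = cell 0 z -> near_box 1 y z.
Proof.
move=> e; apply/forallP => i; move/rowP: e => /(_ i); rewrite !mxE !expr0 !mul1r => e.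
have [] := (floor_itv (y 0 i), floor_itv (z 0 i)); rewrite e !intrD.
by move=> /andP[? ?] /andP[? ?]; rewrite ler_norml; lra.
Qed.

(** Let l be the largest level up to j at which y and z are within 2^-l in every coordinate. If l <
    j, some coordinate differs by more than 2^-(l+1), and [sproj_small] puts the directions in two
    boxes of radius 8/2^(j-l); if l = j, the trivial bound 1 is enough. The right-hand side sums
    over all levels so that it can be integrated over [z]. *)
Lemma directions_mass (R : realType) (n : nat) (a : R) (j : nat)
  (nu : seq ('rV[R]_n * R)) k (y z : 'rV[R]_n) :
  0 < a -> frostman a j nu -> (forall u, u \in nu -> cell 0 u.1 = k) ->
  (forall u, u \in nu -> enorm u.1 = 1) -> cell 0 y = cell 0 z ->
  mass nu (fun x => enorm (sproj x (z - y)) < 2 / 2 ^+ j) <=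
  2 * (17 ^ n)%:R * \sum_(l < j.+1 | near_box (2 ^+ l)^-1 y z) a ^+ (j - l).
Proof.
move=> a0 fr nuk nu1 yz; have nu0 := fr.1.
set N := mass _ _; set B := 2 * _.
have B1 : 1 <= B.
  by rewrite /B -natrM ler1n muln_gt0 expn_gt0.
have ex : exists l, (l <= j)%N && near_box (2 ^+ l)^-1 y z.
  by exists 0%N; rewrite /= expr0 invr1 near_unit_cell.
case: (@ex_maxnP _ j ex) => [l /andP[]//|l /andP[lj nl] lmax].
suff NB : N <= B * a ^+ (j - l).
  apply: le_trans NB _; rewrite ler_pM2l; last by apply: lt_le_trans B1.
  rewrite (bigD1 (Ordinal (lj : (l < j.+1)%N))) //= lerDl.
  by apply: sumr_ge0 => m _; rewrite exprn_ge0 // ltW.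
move: lj; rewrite leq_eqVlt => /orP[/eqP ->|lj].
  rewrite subnn expr0 mulr1; apply: le_trans B1; exact: frostman_total fr nuk.
have : ~~ near_box (2 ^+ l.+1)^-1 y z.
  by apply/negP => nl1; have := lmax l.+1; rewrite lj nl1 ltnn => /(_ isT).
rewrite negb_forall => /existsP[i]; rewrite -ltNge.
have -> : z 0 i - y 0 i = (z - y) 0 i by rewrite !mxE.
have d0 : 0 < (2 ^+ l.+1)^-1 :> R by rewrite invr_gt0 exprn_gt0.
move=> /(@sproj_small _ _ _ _ (2 / 2 ^+ j) _ d0) [e he].
have radius : 2 * (2 / 2 ^+ j) / (2 ^+ l.+1)^-1 = 8%:R / 2 ^+ (j - l) :> R.
  rewrite -{1}(subnK (ltnW lj)) exprD exprS; field.
  by rewrite !expf_eq0 /= !(negbTE (lt0r_neq0 _)) ?andbF.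
apply: le_trans (@mass_has _ _ nu _ [:: e; - e] _
  (near_box (8%:R / 2 ^+ (j - l))) nu0 _) _.
  move=> u us /(he _ (nu1 _ us)); rewrite radius /= orbF.
  by case=> h; apply/orP; [left|right]; apply/forallP.
rewrite !big_cons big_nil addr0 /B -mulrA [leRHS]mulrDl mul1r.
by apply: lerD; apply: (frostman_box 8) fr _; rewrite leq_subr.
Qed.

(** Kaufman's argument: the tube energy is integrated against a Frostman measure nu on the set of
    bad directions. The integral is at least tau times the mass of nu, hence tau times the
    content. *)
Lemma energy_content (R : realType) (n : nat) (a g tau : R) (j J : nat)
  (mu : seq ('rV[R]_n * R)) k k' :
  0 < g -> g < a -> 0 < tau -> (j <= J)%N -> frostman g J mu ->
  (forall u, u \in mu -> cell 0 u.1 = k) ->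
  (net_content a [set x : 'rV[R]_n | [/\ cell 0 x = k', enorm x = 1%R &
     (tau <= tube_energy mu (2 / 2 ^+ j) x)%R]] <=
   (energy_const n a g * a ^+ j / tau)%:E)%E.
Proof.
move=> g0 ga tau0 jJ fmu muk; have a0 := lt_trans g0 ga.
set G := [set x | _].
have Gk : G `<=` [set x | cell 0 x = k'] by move=> x [].
have [nu [fnu nuG le]] := frostman_exists j a0 Gk.
apply: le_trans le _; rewrite lee_fin ler_pdivlMr //.
have [nu0 mu0] := (fnu.1, fmu.1).
have nuk u : u \in nu -> cell 0 u.1 = k' by move=> /nuG[].
have nu1 u : u \in nu -> enorm u.1 = 1 by move=> /nuG[].
apply: (@le_trans _ _ (\sum_(u <- nu) u.2 * tube_energy mu (2 / 2 ^+ j) u.1)).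
  rewrite mulr_suml big_seq [leRHS]big_seq; apply: ler_sum => u us.
  by rewrite ler_wpM2l ?nu0 //; case: (nuG _ us).
(* Fubini: for a fixed pair of points, the direction becomes the inner variable. *)
have -> : \sum_(u <- nu) u.2 * tube_energy mu (2 / 2 ^+ j) u.1 =
    \sum_(p <- mu) p.2 * \sum_(q <- mu) q.2 *
      mass nu (fun x => enorm (sproj x (q.1 - p.1)) < 2 / 2 ^+ j).
  under eq_bigr do rewrite mulr_sumr.
  rewrite exchange_big; apply: eq_bigr => p _.
  under eq_bigr do rewrite mulrCA.
  rewrite -mulr_sumr; congr (_ * _); rewrite /mass.
  under eq_bigr do rewrite mulr_sumr big_mkcond.
  rewrite exchange_big; apply: eq_bigr => q _.
  rewrite mulr_sumr [RHS]big_mkcond; apply: eq_bigr => u _.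
  by case: ifP => // _; rewrite mulrC.
(* Level l contributes the mu-mass 3^n g^l of a box around [p] times the bound a^(j-l) on
   directions; as g < a, this is a^j times a convergent geometric series. *)
pose S := \sum_(l < j.+1) (3 ^ n)%:R * g ^+ l * a ^+ (j - l).
have inner p : p \in mu -> \sum_(q <- mu) q.2 *
    mass nu (fun x => enorm (sproj x (q.1 - p.1)) < 2 / 2 ^+ j) <=
    2 * (17 ^ n)%:R * S.
  move=> pmu.
  apply: (@le_trans _ _ (\sum_(q <- mu) q.2 * (2 * (17 ^ n)%:R *
    \sum_(l < j.+1 | near_box (2 ^+ l)^-1 p.1 q.1) a ^+ (j - l)))).
    rewrite big_seq [leRHS]big_seq; apply: ler_sum => q qmu.
    rewrite ler_wpM2l ?mu0 //; apply: (directions_mass a0 fnu nuk nu1).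
    by rewrite (muk _ pmu) (muk _ qmu).
  under eq_bigr do rewrite mulrCA.
  rewrite -mulr_sumr ler_pM2l ?mulr_gt0 ?ltr0n ?expn_gt0 //.
  under eq_bigr do rewrite mulr_sumr big_mkcond.
  rewrite exchange_big; apply: ler_sum => l _.
  have lJ : (l <= J)%N by rewrite (leq_trans _ jJ) // -ltnS ltn_ord.
  have := frostman_box 1 p.1 fmu lJ; rewrite mul1r muln1 => box.
  have aj : 0 <= a ^+ (j - l) by rewrite exprn_ge0 // ltW.
  apply: le_trans (ler_wpM2r aj box); rewrite /mass mulr_suml.
  rewrite [leRHS]big_mkcond; apply: ler_sum => q _.
  by case: ifP.
have Sle : S <= (3 ^ n)%:R * a ^+ j / (1 - g / a).
  have ga1 : 0 < 1 - g / a by rewrite subr_gt0 ltr_pdivrMr // mul1r.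
  rewrite ler_pdivlMr //.
  have -> : S = (3 ^ n)%:R * a ^+ j * \sum_(l < j.+1) (g / a) ^+ l.
    rewrite mulr_sumr; apply: eq_bigr => l _.
    have lj : (l <= j)%N by rewrite -ltnS.
    have -> : a ^+ j = a ^+ l * a ^+ (j - l) by rewrite -exprD subnKC.
    rewrite exprMn exprVn; field.
    by rewrite expf_eq0 negb_and (lt0r_neq0 a0) orbT.
  rewrite -[leLHS]mulrA ler_piMr //.
    by rewrite mulr_ge0 ?ler0n ?exprn_ge0 // ltW.
  have -> : (\sum_(l < j.+1) (g / a) ^+ l) * (1 - g / a) = 1 - (g / a) ^+ j.+1.
    by rewrite mulrC -opprB mulNr -subrX1 opprB.
  by rewrite gerBl exprn_ge0 // divr_ge0 // ltW.
have S0 : 0 <= 2 * (17 ^ n)%:R * S.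
  by rewrite !mulr_ge0 ?ler0n // sumr_ge0 // => l _; rewrite !mulr_ge0 ?exprn_ge0 ?ler0n // ltW.
apply: (@le_trans _ _ (mass mu predT * (2 * (17 ^ n)%:R * S))).
  rewrite /mass mulr_suml big_seq [leRHS]big_seq; apply: ler_sum => p pmu.
  by rewrite ler_wpM2l ?mu0 ?inner.
apply: (@le_trans _ _ (2 * (17 ^ n)%:R * S)).
  by rewrite ler_piMl // (frostman_total _ fmu muk).
rewrite /energy_const -!mulrA !ler_pM2l ?ltr0n ?expn_gt0 //.
by apply: le_trans Sle _; rewrite -!mulrA [X in _ * X]mulrC.
Qed.

(** * Analytic sets *)

Notation baire := (prod_topology (fun _ : nat => nat)).

Definition below (b : nat -> nat) (i : nat) : set baire :=
  [set x | forall k, (k < i)%N -> (x k <= b k)%N].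

(** The range of [f] is the increasing union over m of the images of the sets where a given
    coordinate is at most m. Continuity of the content allows one coordinate after another to be
    bounded while the content stays above kappa. *)
Lemma below_content (R : realType) (n : nat) (g kappa : R)
  (B : set 'rV[R]_n) (f : baire -> 'rV[R]_n) :
  0 <= g -> (kappa%:E < net_content g (B `&` range f))%E ->
  exists b, forall i, (kappa%:E < net_content g (B `&` f @` below b i))%E.
Proof.
move=> g0 kB.
pose good (C : set baire) := (kappa%:E < net_content g (B `&` f @` C))%E.
have step (p : set baire * nat) : exists m, good p.1 ->
    good (p.1 `&` [set x | (x p.2 <= m)%N]).
  case: p => C i /=; case: (boolP (good C)) => [gC|gC]; last by exists 0%N.
  suff [m gm] : exists m, good (C `&` [set x : baire | (x i <= m)%N]) by exists m.
  apply/not_existsP => h; move: gC; rewrite /good ltNge => /negP; apply.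
  have -> : B `&` f @` C =
      \bigcup_m (B `&` f @` (C `&` [set x : baire | (x i <= m)%N])).
    apply/seteqP; split=> [y [By [x Cx e]]|y [m _ [By [x [Cx _] e]]]].
      by exists (x i) => //; split => //; exists x => //; split => /=.
    by split=> //; exists x.
  apply: net_content_bigcup_nondecreasing => // [m y [By [x [Cx /= xm] e]]|m].
    by split=> //; exists x => //; split=> //=; exact: leqW.
  by rewrite leNgt; apply/negP/h.
have [m mP] := choice step.
pose S := fix S i : set baire :=
  if i is i'.+1 then S i' `&` [set x | (x i' <= m (S i', i'))%N] else setT.
exists (fun i => m (S i, i)) => i.
suff -> : below (fun i => m (S i, i)) i = S i.
  elim: i => [|i IH]; first exact: kB.
  exact: (mP (S i, i)).
elim: i => [|i IH]; first by apply/seteqP; split.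
apply/seteqP; split=> x.
  move=> xb; split; last exact: (xb i (ltnSn i)).
  by rewrite -/S -IH => k ki; exact/xb/ltnW.
move=> [+ xi]; rewrite -/S -IH => xb k.
by rewrite ltnS leq_eqVlt => /orP[/eqP -> //|]; exact: xb.
Qed.

Lemma cvg_baire (F : set_system baire) (p : baire) :
  Filter F -> (forall k, F [set x | x k = p k]) -> F --> p.
Proof.
move=> FF Fp; apply/cvg_sup => k A /= [_ [[C Cop <-] /= Cp] sCA].
by apply: filterS (Fp k) => x /= e; apply: sCA; rewrite /= e.
Qed.

Lemma nbhs_baire (p : baire) (A : set baire) : nbhs p A ->
  exists M, [set x | forall k, (k < M)%N -> x k = p k] `<=` A.
Proof.
move=> pA; apply: contrapT => /forallNP h.
have /choice[x xP] : forall M, exists x : baire,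
    (forall k, (k < M)%N -> x k = p k) /\ ~ A x.
  move=> M; apply: contrapT => nx; apply: (h M) => x xp.
  by apply: contrapT => Ax; apply: nx; exists x.
have /(_ A pA) : x @ \oo --> p.
  apply: cvg_baire => k; exists k.+1 => // M /= kM.
  by have [xp _] := xP M; exact: xp.
move=> [M _ /(_ M (leqnn M)) /=]; by have [] := xP M.
Qed.

Lemma baire_nbhs (p : baire) M :
  nbhs p [set x : baire | forall k, (k < M)%N -> x k = p k].
Proof.
elim: M => [|M IH]; first by apply: filterS filterT.
have pM : nbhs p [set x : baire | x M = p M].
  have := @proj_continuous nat (fun _ => nat) M p [set p M].
  by apply; rewrite nbhs_principalE.
apply: filterS (filterI IH pM) => x [xp xM] k.
by rewrite ltnS leq_eqVlt => /orP[/eqP -> //|]; exact: xp.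
Qed.

(** Otherwise there are x_i, bounded by [b] in the first i coordinates, with f(x_i) outside the
    first i open sets. Their truncations by [b] cluster at some p in a compact product. Near p the
    values of [f] lie in one [U l], and some x_i with i > l agrees with p on enough coordinates, a
    contradiction. *)
Lemma below_compact (T : topologicalType) (f : baire -> T) (U : nat -> set T)
  (b : nat -> nat) :
  continuous f -> (forall l, open (U l)) -> range f `<=` \bigcup_l U l ->
  exists i, f @` below b i `<=` \bigcup_(l in [set l | (l < i)%N]) U l.
Proof.
move=> cf oU fU; apply: contrapT => /forallNP h.
have /choice[x /all_and2[xb xU]] : forall i, exists x : baire,
    below b i x /\ forall l, (l < i)%N -> ~ U l (f x).
  move=> i; apply: contrapT => nx; apply: (h i) => _ [x xb <-].
  apply: contrapT => Ux; apply: nx; exists x; split=> // l li Ul.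
  by apply: Ux; exists l.
(* Truncation leaves the first [i] coordinates of [x i] unchanged. *)
pose y i : baire := fun k => minn (x i k) (b k).
have cptK : compact [set z : baire | forall k, (z k <= b k)%N].
  apply: (@tychonoff nat (fun _ => nat) (fun k => [set m | (m <= b k)%N])) => k.
  apply/finite_compact/(sub_finite_set _ (finite_II (b k).+1)) => m /=.
  by rewrite ltnS.
have FK : (y @ \oo) [set z : baire | forall k, (z k <= b k)%N].
  by exists 0%N => // i _ k /=; rewrite geq_minr.
have [p [_ clp]] := cptK _ _ FK.
have [l _ Ulp] := fU (f p) (imageT f p).
have [M MU] := nbhs_baire (cf p (U l) (open_nbhs_nbhs (conj (oU l) Ulp))).
have Fy : (y @ \oo) [set z | exists2 i, (maxn M l.+1 <= i)%N & z = y i].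
  by exists (maxn M l.+1) => // i /= Mi; exists i.
have [_ [[i Mi ->] yp]] := clp _ _ Fy (baire_nbhs p M).
have /MU : forall k, (k < M)%N -> x i k = p k.
  move=> k kM; rewrite -(yp k kM) /y; apply/esym/minn_idPl/xb.
  by rewrite (leq_trans kM) // (leq_trans (leq_maxl M l.+1)).
by apply: xU; rewrite (leq_trans (leq_maxr M l.+1)).
Qed.

(** * Tubes *)

Lemma sprojB (R : realType) (n : nat) (x u v : 'rV[R]_n) :
  sproj x (u - v) = sproj x u - sproj x v.
Proof.
rewrite /sproj edotDl edotNl scalerBl !opprD !opprK -!addrA; congr (_ + _).
by rewrite addrCA.
Qed.

Lemma edot_sqrD (R : realType) (n : nat) (u v : 'rV[R]_n) :
  edot (u + v) (u + v) = edot u u + 2 * edot v u + edot v v.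
Proof. by rewrite edotDl ![edot _ (u + v)]edotC !edotDl (edotC u v); ring. Qed.

Lemma enorm_sub_lt (R : realType) (n : nat) (u v : 'rV[R]_n) (r : R) :
  enorm u < r -> enorm v < r -> enorm (u - v) < 2 * r.
Proof.
move=> ur vr; have [u0 v0] := (enorm_ge0 u, enorm_ge0 v).
rewrite -ltr_sqr ?nnegrE ?enorm_ge0 //; last by nra.
have := edot_ge0 (u + v); rewrite sqr_enorm !edot_sqrD !edotNl (edotC v (- v)).
rewrite edotNl opprK -!sqr_enorm; nra.
Qed.

Lemma open_tube (R : realType) (n : nat) (x c : 'rV[R]_n) (r : R) :
  open [set z | enorm (sproj x (z - c)) < r].
Proof.
pose F (z : 'rV[R]_n) := enorm (sproj x (z - c)).
have cF : continuous F.
  move=> z; pose G (y : 'rV[R]_n) := edot (sproj x (y - c)) (sproj x (y - c)).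
  apply: (@continuous_comp _ _ _ G Num.sqrt); last exact: sqrt_continuous.
  have cont_sum (h : 'I_n -> 'rV[R]_n -> R) : (forall i, {for z, continuous (h i)}) ->
      {for z, continuous (fun y => \sum_(i < n) h i y)}.
    move=> ch; have cadd : continuous (fun w : R * R => w.1 + w.2).
      by move=> w; apply: cvgD; [exact: cvg_fst|exact: cvg_snd].
    exact: (@cvg_big R 'I_n +%R 0 xpredT cadd _ (nbhs z) _ h _ _ (fun i _ => ch i)).
  have coord i : {for z, continuous (fun y : 'rV[R]_n => (y - c) 0 i)}.
    rewrite (_ : (fun y => _) = (fun y : 'rV[R]_n => y 0 i - c 0 i)); last first.
      by apply/funext => y; rewrite !mxE.
    have cz : (fun y : 'rV[R]_n => y 0 i) @ z --> z 0 i.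
      exact: (@coord_continuous R 1 n 0 i z).
    exact: cvgB cz (cvg_cst _).
  have sp i : {for z, continuous (fun y : 'rV[R]_n => sproj x (y - c) 0 i)}.
    rewrite (_ : (fun y => _) = (fun y : 'rV[R]_n =>
      (y - c) 0 i - (\sum_(k < n) (y - c) 0 k * x 0 k) * x 0 i)); last first.
      by apply/funext => y; rewrite /sproj /edot !mxE.
    have csum : {for z, continuous (fun y : 'rV[R]_n => \sum_(k < n) (y - c) 0 k * x 0 k)}.
      apply: (cont_sum (fun k (y : 'rV[R]_n) => (y - c) 0 k * x 0 k)) => k.
      exact: cvgM (coord k) (cvg_cst _).
    exact: cvgB (coord i) (cvgM csum (cvg_cst _)).
  apply: (cont_sum (fun i (y : 'rV[R]_n) => sproj x (y - c) 0 i * sproj x (y - c) 0 i)) => i.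
  exact: cvgM (sp i) (sp i).
exact: (open_comp (fun z _ => cF z) (@open_lt R r)).
Qed.

(** The thresholds [ty j] sum to at most kappa, so the tubes of some width 2^-j carry more than
    [ty j]. There are at most b^-j of them, which makes pairs of points sharing a tube frequent
    enough to bound the energy from below. *)
Lemma tubes_energy (R : realType) (n N j0 : nat) (b h kappa : R)
  (mu : seq ('rV[R]_n * R)) (x : 'rV[R]_n) (c : nat -> 'rV[R]_n)
  (l : nat -> nat) :
  0 < b -> b < 1 -> 0 < h -> h < 1 -> 0 < kappa ->
  (forall u, u \in mu -> 0 <= u.2) -> kappa < mass mu predT ->
  (forall u, u \in mu -> exists2 i, (i < N)%N &
     enorm (sproj x (u.1 - c i)) < (2 ^+ l i)^-1) ->
  \sum_(i < N) b ^+ l i <= b ^+ j0 ->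
  exists2 i, (i < N)%N & (j0 <= l i)%N /\
    (kappa * (1 - h) * h ^+ l i) ^+ 2 * b ^+ l i / 4 <=
    tube_energy mu (2 / 2 ^+ l i) x.
Proof.
move=> b0 b1 h0 h1 k0 mu0 kmu tubes bsum.
pose U i z := enorm (sproj x (z - c i)) < (2 ^+ l i)^-1.
pose ty j := kappa * (1 - h) * h ^+ j.
pose L := (\max_(i < N) l i).+1.
have ty_sum : \sum_(0 <= j < L) ty j <= kappa.
  rewrite big_mkord -mulr_sumr -mulrA ler_piMr ?(ltW k0) //.
  have -> : (1 - h) * (\sum_(i < L) h ^+ i) = 1 - h ^+ L.
    by rewrite -opprB mulNr -subrX1 opprB.
  by rewrite gerBl exprn_ge0 // ltW.
pose T j : pred 'rV[R]_n := fun z => has (fun i => (l i == j) && U i z) (iota 0 N).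
have [j Tj] : exists j, ty j < mass mu (T j).
  apply: contrapT => /forallNP hj; move: kmu; apply/negP; rewrite -leNgt.
  apply: le_trans ty_sum; rewrite /index_iota subn0.
  apply: le_trans (@mass_has _ _ mu _ (iota 0 L) predT T mu0 _) _.
    move=> u /tubes [i iN Uu] _; apply/hasP; exists (l i).
      rewrite mem_iota add0n ltnS.
      exact: (@leq_bigmax _ (fun i : 'I_N => l i) (Ordinal iN)).
    by apply/hasP; exists i; rewrite ?mem_iota // eqxx.
  by apply: ler_sum => j _; rewrite leNgt; apply/negP/hj.
have tyj : 0 < ty j by rewrite !mulr_gt0 ?exprn_gt0 // subr_gt0.
pose idx := [seq i <- iota 0 N | l i == j].
have idx_sum : (size idx)%:R * b ^+ j <= b ^+ j0.
  apply: le_trans bsum; rewrite -(big_mkord xpredT (fun i => b ^+ l i)).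
  rewrite /index_iota subn0 (bigID (fun i => l i == j)) /= ler_wpDr //.
    by apply: sumr_ge0 => i _; rewrite exprn_ge0 // ltW.
  rewrite -big_filter -/idx (eq_big_seq (fun=> b ^+ j)).
    by rewrite big_const_seq count_predT iter_addr addr0 mulr_natl.
  by move=> i; rewrite mem_filter => /andP[/eqP ->].
have [i idxi] : exists i, i \in idx.
  case E : idx => [|i s]; last by exists i; rewrite mem_head.
  move: Tj; rewrite /mass big_hasC ?(ltNge _ 0) ?(ltW tyj) //.
  apply/hasPn => u _; apply/hasPn => i iN; apply/negP => /andP[lij _].
  have : i \in idx by rewrite mem_filter lij.
  by rewrite E.
move: (idxi); rewrite mem_filter mem_iota add0n => /and3P[/eqP lij _ iN].
(* A single tube of this level already costs b^j, which is therefore at most b^j0. *)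
have j0j : (j0 <= j)%N.
  rewrite -(ler_iXn2l b0 b1); apply: le_trans idx_sum.
  rewrite ler_peMl ?exprn_ge0 ?(ltW b0) // ler1n.
  by case: (idx) idxi.
exists i => //; rewrite lij; split=> //.
(* Points whose own tube has mass less than tau carry at most half of the mass of
   T j, because T j is covered by (size idx) <= b^-j tubes. *)
pose phi p := mass mu (fun z => enorm (sproj x (z - p)) < 2 / 2 ^+ j).
pose tau := ty j * b ^+ j / 2.
have tau0 : 0 < tau by rewrite divr_gt0 // mulr_gt0 // exprn_gt0.
(* If tube [i'] contains a light point, the tube of doubled radius around that point contains all of
   tube [i']. *)
have light i' : i' \in idx -> mass mu (fun z => U i' z && (phi z < tau)) <= tau.
  rewrite mem_filter => /andP[/eqP li' _].
  case: (boolP (has (fun u => U i' u.1 && (phi u.1 < tau)) mu)) => [/hasP|hn].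
    move=> [u umu /andP[Uu ltu]]; apply: le_trans (ltW ltu).
    apply: ler_mass => // v _ /andP[Uv _].
    have -> : v.1 - u.1 = (v.1 - c i') - (u.1 - c i') by rewrite opprB addrA subrK.
    by rewrite sprojB -li'; exact: enorm_sub_lt.
  by rewrite /mass big_hasC // ltW.
have half : ty j / 2 <= mass mu (fun z => tau <= phi z).
  (* [None] stands for the heavy points, [Some i'] for the light ones in tube [i']. *)
  have : mass mu (T j) <= \sum_(o <- None :: map Some idx)
      mass mu (fun z => if o is Some i' then U i' z && (phi z < tau) else tau <= phi z).
    apply: mass_has => // u _ /hasP[i' i'N /andP[li' Uu]].
    rewrite /=; case: leP => //= lt; apply/hasP; exists (Some i').
      by rewrite map_f // mem_filter li'.
    by rewrite /= Uu.
  rewrite big_cons big_map /= => le.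
  have : \sum_(i' <- idx) mass mu (fun z => U i' z && (phi z < tau)) <= (size idx)%:R * tau.
    rewrite big_seq.
    apply: le_trans (ler_sum _ light) _.
    by rewrite -big_seq big_const_seq count_predT iter_addr addr0 mulr_natl.
  have : (size idx)%:R * tau <= ty j / 2.
    rewrite (_ : _ * _ = (size idx)%:R * b ^+ j * (ty j / 2)); last by rewrite /tau; ring.
    rewrite ler_piMl ?(ltW tyj, divr_ge0) //; apply: le_trans idx_sum _.
    by rewrite exprn_ile1 // ltW.
  move: le Tj; lra.
apply: (@le_trans _ _ (tau * (ty j / 2))).
  by rewrite /tau -/(ty j) expr2; set e := ty j; lra.
apply: (@le_trans _ _ (tau * mass mu (fun z => tau <= phi z))).
  by rewrite ler_pM2l.
rewrite /mass mulr_sumr big_mkcond big_seq /tube_energy [leRHS]big_seq.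
apply: ler_sum => u umu; case: ifP => [le|_].
  by rewrite mulrC ler_wpM2l ?mu0.
by rewrite mulr_ge0 ?mu0 // mass_ge0.
Qed.

(** * Null content of the exceptional directions *)

Lemma expr_small (R : realType) (x e : R) :
  0 <= x -> x < 1 -> 0 < e -> exists N, x ^+ N < e.
Proof.
move=> x0 x1 e0; have xabs : `|x| < 1 by rewrite ger0_norm.
have /cvgrPdist_lt/(_ e e0)[N _ /(_ N (leqnn N)) /=] := cvg_expr xabs.
by rewrite sub0r normrN ger0_norm ?exprn_ge0 // => xN; exists N.
Qed.

Lemma geometric_tail_le (R : realType) (x : R) (j m : nat) :
  0 <= x -> x < 1 -> \sum_(j <= i < m) x ^+ i <= x ^+ j / (1 - x).
Proof.
move=> x0 x1; have x1' : 0 < 1 - x by rewrite subr_gt0.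
have [jm|mj] := leqP j m; last first.
  by rewrite big_geq ?(ltnW mj) // divr_ge0 ?exprn_ge0 // ltW.
rewrite ler_pdivlMr // mulr_suml.
rewrite (eq_bigr (fun i => - x ^+ i.+1 - - x ^+ i)); last first.
  by move=> i _; rewrite exprS; ring.
by rewrite telescope_sumr // opprK addrC gerBl exprn_ge0.
Qed.

Lemma net_content_cells0 (R : realType) (n : nat) (a : R) (A : set 'rV[R]_n) :
  0 <= a -> (forall k, net_content a (A `&` [set x | cell 0 x = k]) = 0%E) ->
  net_content a A = 0%E.
Proof.
move=> a0 Ak.
have -> : A = \bigcup_m (A `&` [set x | pickle (cell 0 x) = m]).
  by apply/seteqP; split=> [x Ax|x [m _ []] //]; exists (pickle (cell 0 x)).
apply: net_content_bigcup0 => // m; apply/eqP; rewrite eq_le net_content_ge0 // andbT.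
have [[x [Ax xm]]|none] := pselect (exists x, A x /\ pickle (cell 0 x) = m).
  rewrite -(Ak (cell 0 x)); apply: le_net_content => y [Ay /= ym]; split=> //=.
  by apply: (pcan_inj pickleK); rewrite xm ym.
rewrite -(Ak 0); apply: le_net_content => y [Ay /= ym]; case: none.
by exists y.
Qed.

Lemma net_content_big (R : realType) (n : nat) (a : R) (s : seq nat)
  (A : nat -> set 'rV[R]_n) (e : nat -> R) :
  0 <= a -> (forall j, j \in s -> (net_content a (A j) <= (e j)%:E)%E) ->
  (net_content a [set x | exists2 j, j \in s & A j x] <=
   (\sum_(j <- s) e j)%:E)%E.
Proof.
move=> a0; elim: s => [|j s IH] Ae.
  rewrite big_nil (_ : [set x | _] = set0) ?net_content_set0 //.
  by apply/seteqP; split=> x // -[].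
rewrite big_cons EFinD; apply: le_trans (leeD (Ae j (mem_head _ _)) (IH _)); last first.
  by move=> i si; apply: Ae; rewrite inE si orbT.
apply: le_trans (net_contentU _ _ a0); apply: le_net_content => x [i].
by rewrite inE => /orP[/eqP ->|si] Ax; [left|right; exists i].
Qed.

(** Here [b], [a], [g] stand for 2^-s, 2^-t, 2^-u with s < t < u. By compactness finitely many tubes
    cover the part of [Z] carrying the measures, so each x in [E] has large tube energy at some
    scale 2^-j with j >= j0. By [energy_content] the contents of these bad sets decay geometrically
    in j, and the tail from [j0] on is arbitrarily small. *)
Lemma tubes_content0 (R : realType) (n : nat) (a b g : R) (Z E : set 'rV[R]_n)
  (f : baire -> 'rV[R]_n) :
  0 < g -> g < a -> a < b -> b < 1 -> continuous f -> range f = Z ->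
  net_content g Z <> 0%E ->
  (forall x, E x -> enorm x = 1) ->
  (forall x, E x -> forall j0, exists (c : nat -> 'rV[R]_n) (l : nat -> nat),
     (forall z, Z z -> exists i, enorm (sproj x (z - c i)) < (2 ^+ l i)^-1) /\
     forall N, \sum_(i < N) b ^+ l i <= b ^+ j0) ->
  net_content a E = 0%E.
Proof.
move=> g0 ga ab b1 cf fZ Zg E1 Etubes.
have a0 := lt_trans g0 ga; have b0 := lt_trans a0 ab.
have [k Zk] : exists k, net_content g (Z `&` [set x | cell 0 x = k]) <> 0%E.
  apply: contrapT => /forallNP h; apply: Zg; apply: net_content_cells0 => [|k].
    exact: ltW.
  exact: contrapT (h k).
have [kappa [kappa0 kZ]] : exists kappa : R, 0 < kappa /\
    (kappa%:E < net_content g (Z `&` [set x | cell 0 x = k]))%E.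
  move: Zk (net_content_ge0 (Z `&` [set x | cell 0 x = k]) (ltW g0)).
  case: (net_content _ _) => [r||] //.
    move=> r0; rewrite lee_fin le_eqVlt => /orP[/eqP r0'|r0'].
      by case: r0; rewrite -r0'.
    by exists (r / 2); rewrite divr_gt0 // lte_fin; split=> //; lra.
  by move=> _ _; exists 1; rewrite ltry.
rewrite setIC -fZ in kZ.
have [bd bdP] := below_content (ltW g0) kZ.
(* The measures for different [J] are chosen independently; they share the bounds [bd] and the lower
   bound [kappa] on the mass. *)
have /choice[mu muP] : forall J, exists mu : seq ('rV[R]_n * R),
    [/\ frostman g J mu,
        forall u, u \in mu -> ([set x | cell 0 x = k] `&` f @` below bd J) u.1
      & kappa < mass mu predT].
  move=> J; have sub : [set x | cell 0 x = k] `&` f @` below bd J `<=`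
      [set x | cell 0 x = k] by move=> x [].
  have [mu [fmu muA le]] := frostman_exists J g0 sub.
  by exists mu; split=> //; rewrite -lte_fin; apply: lt_le_trans (bdP J) le.
(* The only role of h is that h < 1 and a < b h^2: the masses h^j are summable,
   and the contents (a / (b h^2))^j of the bad sets at scale j still decay. *)
pose h := (1 + a / b) / 2.
have ab1 : 0 < a / b < 1 by rewrite divr_gt0 // ltr_pdivrMr // mul1r.
have [h0 h1] : 0 < h /\ h < 1 by move: ab1 => /andP[? ?]; rewrite /h; split; lra.
have bh0 : 0 < b * h ^+ 2 by rewrite mulr_gt0 // exprn_gt0.
pose lam := a / (b * h ^+ 2).
have lam0 : 0 < lam by rewrite divr_gt0.
have lam1 : lam < 1.
  rewrite ltr_pdivrMr // mul1r -ltr_pdivrMl // mulrC /h.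
  move: ab1; set q := a / b => /andP[q0 q1]; nra.
pose tau j := (kappa * (1 - h) * h ^+ j) ^+ 2 * b ^+ j / 4.
have tau0 j : 0 < tau j.
  have k1 : 0 < kappa * (1 - h) by rewrite mulr_gt0 // subr_gt0.
  by rewrite /tau divr_gt0 // mulr_gt0 ?exprn_gt0 // mulr_gt0 // exprn_gt0.
pose C := energy_const n a g * 4 / (kappa * (1 - h)) ^+ 2.
have C0 : 0 <= C.
  rewrite /C divr_ge0 ?sqr_ge0 // mulr_ge0 // /energy_const divr_ge0 ?mulr_ge0 ?ler0n //.
  by rewrite subr_ge0 ler_pdivrMr // mul1r ltW.
have rate j : energy_const n a g * a ^+ j / tau j = C * lam ^+ j.
  have -> : lam ^+ j = a ^+ j / (b ^+ j * (h ^+ j) ^+ 2).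
    by rewrite /lam expr_div_n exprMn exprAC.
  have [bj hj] : b ^+ j != 0 /\ h ^+ j != 0 by split; rewrite lt0r_neq0 // exprn_gt0.
  rewrite /C /tau; field.
  by rewrite bj hj (lt0r_neq0 kappa0) subr_eq0 (gt_eqF h1).
apply: net_content_cells0 => [|k']; first exact: ltW.
apply/eqP; rewrite eq_le net_content_ge0 ?(ltW a0) // andbT.
apply/lee_addgt0Pr => e e0; rewrite add0e.
have [j0 j0e] : exists j0, lam ^+ j0 < e / (C / (1 - lam) + 1).
  apply: expr_small => //; first exact: ltW.
  by rewrite divr_gt0 // ltr_wpDl // divr_ge0 // subr_ge0 ltW.
have Cj0 : C * (lam ^+ j0 / (1 - lam)) <= e.
  have D0 : 0 <= C / (1 - lam) by rewrite divr_ge0 // subr_ge0 ltW.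
  move: j0e; rewrite ltr_pdivlMr ?ltr_wpDl // => j0e.
  have : 0 <= lam ^+ j0 by rewrite exprn_ge0 // ltW.
  by rewrite mulrCA mulrA in j0e *; nra.
(* Asking for all [J >= m] makes [P] increasing in [m], so continuity of the content applies; the
   content of one [P m] is then estimated with J = m. *)
pose P m := [set x | [/\ E x, cell 0 x = k' & forall J, (m <= J)%N ->
  exists2 j, (j0 <= j < m)%N & tau j <= tube_energy (mu J) (2 / 2 ^+ j) x]].
have EP : E `&` [set x | cell 0 x = k'] `<=` \bigcup_m P m.
  move=> x [Ex xk'].
  have [c [l [cZ bl]]] := Etubes x Ex j0.
  have [i0 i0U] : exists i, f @` below bd i `<=`
      \bigcup_(i' in [set i' | (i' < i)%N])
        [set z | enorm (sproj x (z - c i')) < (2 ^+ l i')^-1].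
    apply: below_compact => // [i|z]; first exact: open_tube.
    by rewrite fZ => /cZ[i zi]; exists i.
  (* [J >= i0] puts the support of [mu J] inside the first [i0] tubes; the other term exceeds all
     their levels. *)
  exists (maxn i0 (\max_(i < i0) l i).+1) => //; split=> // J mJ.
  have [fmu muA kmu] := muP J.
  have cover u : u \in mu J -> exists2 i, (i < i0)%N &
      enorm (sproj x (u.1 - c i)) < (2 ^+ l i)^-1.
    move=> /muA[_ [w wJ <-]].
    have [|i /= ii0 Ui] := i0U (f w); last by exists i.
    exists w => // q qi0; apply: wJ; apply: leq_trans qi0 _.
    by apply: leq_trans mJ; rewrite leq_maxl.
  have [i ii0 [j0l tl]] := tubes_energy b0 b1 h0 h1 kappa0 fmu.1 kmu cover (bl i0).
  exists (l i) => //; rewrite j0l /= leq_max ltnS.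
  by rewrite (@leq_bigmax _ (fun i : 'I_i0 => l i) (Ordinal ii0)) orbT.
apply: le_trans (le_net_content a EP) _.
apply: net_content_bigcup_nondecreasing => [|m x [Ex xk' h']|m].
- exact: ltW.
- split=> // J mJ; have [|j /andP[j0j jm] tj] := h' J; first exact: ltnW.
  by exists j => //; rewrite j0j ltnW.
pose A j := [set x | [/\ cell 0 x = k', enorm x = 1 &
  tau j <= tube_energy (mu m) (2 / 2 ^+ j) x]].
have PA : P m `<=` [set x | exists2 j, j \in index_iota j0 m & A j x].
  move=> x [Ex xk' /(_ m (leqnn m))[j jm tj]].
  by exists j; [rewrite mem_index_iota|split=> //; exact: E1].
apply: le_trans (le_net_content a PA) _.
have [fmu muA _] := muP m.
apply: le_trans (@net_content_big _ _ _ _ A (fun j => C * lam ^+ j) (ltW a0) _) _.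
  move=> j; rewrite mem_index_iota -rate => /andP[_ jm].
  apply: (energy_content k' g0 ga (tau0 j) (ltnW jm) fmu) => u /muA[uk _].
  exact: uk.
rewrite lee_fin -mulr_sumr; apply: le_trans Cj0; apply: ler_wpM2l => //.
by apply: geometric_tail_le => //; exact: ltW.
Qed.

(** * Hausdorff measure and dimension *)

Lemma enorm0 (R : realType) (n : nat) : enorm (0 : 'rV[R]_n) = 0.
Proof.
rewrite /enorm /edot big1 ?sqrtr0 // => i _; by rewrite mxE mulr0.
Qed.

Lemma ediam_le (R : realType) (n : nat) (A : set 'rV[R]_n) (d : \bar R) :
  (forall x y, A x -> A y -> ((enorm (x - y))%:E <= d)%E) -> (ediam A <= d)%E.
Proof. by move=> h; apply: ge_ereal_sup => _ [[x y] [Ax Ay] <-]; apply: h. Qed.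

Lemma le_ediam (R : realType) (n : nat) (A : set 'rV[R]_n) x y :
  A x -> A y -> ((enorm (x - y))%:E <= ediam A)%E.
Proof. by move=> Ax Ay; apply: ereal_sup_ubound; exists (x, y). Qed.

Lemma ediam_ge0 (R : realType) (n : nat) (A : set 'rV[R]_n) x :
  A x -> (0 <= ediam A)%E.
Proof. by move=> Ax; have := le_ediam Ax Ax; rewrite subrr enorm0. Qed.

Lemma hgauge_ge0 (R : realType) (n : nat) (s : R) (A : set 'rV[R]_n) :
  (0 <= hgauge s A)%E.
Proof. by rewrite /hgauge; case: ifP => // _; exact: poweR_ge0. Qed.

Lemma hgauge_le (R : realType) (n m : nat) (s : R) (A : set 'rV[R]_n)
  (B : set 'rV[R]_m) :
  0 <= s -> (ediam A <= ediam B)%E -> (A !=set0 -> B !=set0) ->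
  (hgauge s A <= hgauge s B)%E.
Proof.
move=> s0 AB AB0; rewrite /hgauge; case: ifPn => [_|/set0P A0].
  exact: hgauge_ge0.
have [b Bb] := AB0 A0; case: A0 => a Aa.
rewrite ifF; last by apply/negP => /eqP B0; rewrite B0 in Bb.
have [dA dB] := (ediam_ge0 Aa, ediam_ge0 Bb).
by apply: gt0_ler_poweR; rewrite // in_itv /= ?dA ?dB leey.
Qed.

Lemma hgauge_le_powR (R : realType) (n : nat) (s d : R) (A : set 'rV[R]_n) :
  0 <= s -> 0 <= d -> (ediam A <= d%:E)%E -> (hgauge s A <= (d `^ s)%:E)%E.
Proof.
move=> s0 d0 Ad; rewrite /hgauge; case: ifPn => [_|/set0P[a Aa]].
  by rewrite lee_fin powR_ge0.
rewrite -poweR_EFin; apply: gt0_ler_poweR => //.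
  by rewrite in_itv /= leey (ediam_ge0 Aa).
by rewrite in_itv /= leey lee_fin d0.
Qed.

Lemma hgauge_anti (R : realType) (n : nat) (s t : R) (A : set 'rV[R]_n) :
  0 <= s -> s <= t -> 0 < t -> (ediam A <= 1)%E -> (hgauge t A <= hgauge s A)%E.
Proof.
move=> s0 st t0 A1; rewrite /hgauge; case: ifPn => // /set0P[a Aa].
move: A1 (ediam_ge0 Aa); case: (ediam A) => [d||] //.
rewrite !poweR_EFin !lee_fin => d1; rewrite le_eqVlt => /orP[/eqP <-|d0].
  by rewrite powR0 ?gt_eqF // powR_ge0.
by apply: ger_powR; rewrite ?d0.
Qed.

Lemma hausdorff_premeasure_ge0 (R : realType) (n : nat) (s delta : R)
  (A : set 'rV[R]_n) : (0 <= hausdorff_premeasure s delta A)%E.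
Proof.
apply: le_ereal_inf_tmp => _ [F _ <-]; apply: nneseries_ge0 => i _ _.
exact: hgauge_ge0.
Qed.

Lemma hausdorff_premeasure_le_measure (R : realType) (n : nat) (s delta : R)
  (A : set 'rV[R]_n) :
  0 < delta -> (hausdorff_premeasure s delta A <= hausdorff_measure s A)%E.
Proof. by move=> d0; apply: ereal_sup_ubound; exists delta. Qed.

Lemma hausdorff_measure_eq0 (R : realType) (n : nat) (s : R) (A : set 'rV[R]_n) :
  (forall delta, 0 < delta -> (hausdorff_premeasure s delta A <= 0)%E) ->
  hausdorff_measure s A = 0%E.
Proof.
move=> h; apply/eqP; rewrite eq_le; apply/andP; split.
  by apply: ge_ereal_sup => _ [delta d0 <-]; exact: h.
apply: le_trans (hausdorff_premeasure_le_measure s A ltr01).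
exact: hausdorff_premeasure_ge0.
Qed.

Lemma hausdorff_measure0_sub (R : realType) (n m : nat) (s : R)
  (A : set 'rV[R]_n) (B : set 'rV[R]_m) (p : 'rV[R]_m -> 'rV[R]_n) :
  0 <= s -> (forall x y, enorm (p x - p y) <= enorm (x - y)) ->
  A `<=` p @` B -> hausdorff_measure s B = 0%E -> hausdorff_measure s A = 0%E.
Proof.
move=> s0 lip AB B0; apply: hausdorff_measure_eq0 => delta d0.
rewrite -B0; apply: le_trans (hausdorff_premeasure_le_measure s B d0).
apply: le_ereal_inf_tmp => _ [F [BF Fd] <-].
have dp i : (ediam (p @` F i) <= ediam (F i))%E.
  apply: ediam_le => _ _ [x Fx <-] [y Fy <-].
  by apply: le_trans (le_ediam Fx Fy); rewrite lee_fin.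
apply: ge_ereal_inf; exists (\sum_(0 <= i <oo) hgauge s (p @` F i))%E.
  exists (fun i => p @` F i) => //; split=> [x /AB[y /BF[i _ Fy] <-]|i].
    by exists i => //; exists y.
  exact: le_trans (dp i) (Fd i).
apply: lee_nneseries => [i _ _|i _]; first exact: hgauge_ge0.
by apply: (hgauge_le s0 (dp i)) => -[_ [x Fx _]]; exists x.
Qed.

(** Null measure passes to larger exponents: covers by sets of diameter at most 1 may be used, and
    on these the gauge does not increase with the exponent. *)
Lemma hausdorff_dim_lt (R : realType) (n : nat) (t : R) (A : set 'rV[R]_n) :
  (hausdorff_dim A < t%:E)%E -> 0 < t /\ hausdorff_measure t A = 0%E.
Proof.
move=> /ereal_inf_lt[_ [s [s0 As] <-]]; rewrite lte_fin => st.
have t0 := le_lt_trans s0 st; split=> //.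
apply: hausdorff_measure_eq0 => delta d0.
have d1 : 0 < Num.min delta 1 by rewrite lt_min d0 ltr01.
rewrite -As; apply: le_trans (hausdorff_premeasure_le_measure s A d1).
apply: le_ereal_inf_tmp => _ [F [AF Fd] <-].
apply: ge_ereal_inf; exists (\sum_(0 <= i <oo) hgauge t (F i))%E.
  exists F => //; split=> // i; apply: le_trans (Fd i) _.
  by rewrite lee_fin ge_min lexx.
apply: lee_nneseries => [i _ _|i _]; first exact: hgauge_ge0.
apply: hgauge_anti => //; first exact: ltW.
by apply: le_trans (Fd i) _; rewrite lee_fin ge_min lexx orbT.
Qed.

Lemma hausdorff_dim_le (R : realType) (n : nat) (s : R) (A : set 'rV[R]_n) :
  0 <= s -> hausdorff_measure s A = 0%E -> (hausdorff_dim A <= s%:E)%E.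
Proof. by move=> s0 As; apply: ereal_inf_lbound; exists s. Qed.

Lemma hausdorff_dim_ge0 (R : realType) (n : nat) (A : set 'rV[R]_n) :
  (0 <= hausdorff_dim A)%E.
Proof. by apply: le_ereal_inf_tmp => _ [s [s0 _] <-]; rewrite lee_fin. Qed.

Lemma hausdorff_dim_image (R : realType) (n m : nat) (A : set 'rV[R]_m)
  (p : 'rV[R]_m -> 'rV[R]_n) :
  (forall x y, enorm (p x - p y) <= enorm (x - y)) ->
  (hausdorff_dim (p @` A) <= hausdorff_dim A)%E.
Proof.
move=> lip; apply: le_ereal_inf_tmp => _ [s [s0 As] <-].
by apply: hausdorff_dim_le => //; apply: hausdorff_measure0_sub As.
Qed.

Lemma powR_half_expr (R : realType) (t : R) (l : nat) :
  (2 `^ (- t)) ^+ l = ((2 ^+ l)^-1) `^ t :> R.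
Proof.
rewrite -powR_mulrn ?powR_ge0 // -powRrM mulNr -mulrN mulrC powRrM.
by rewrite powR_invn.
Qed.

Lemma ediam_cell (R : realType) (n l : nat) k :
  (ediam [set x : 'rV[R]_n | cell l x = k] <= (n%:R / 2 ^+ l)%:E)%E.
Proof.
apply: ediam_le => x y /= xk yk; rewrite lee_fin.
have l0 : 0 < 2 ^+ l :> R by rewrite exprn_gt0.
rewrite -ler_sqr ?nnegrE ?enorm_ge0 ?divr_ge0 ?ler0n ?(ltW l0) // sqr_enorm.
have nn : n%:R <= n%:R ^+ 2 :> R by rewrite -natrX ler_nat -mulnn; case: (n) => // m; rewrite leq_pmulr.
rewrite exprMn; apply: le_trans (ler_wpM2r (sqr_ge0 _) nn).
rewrite /edot -[n in n%:R]card_ord -sum1_card natr_sum mulr_suml.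
apply: ler_sum => i _; rewrite mul1r -expr2.
have : cell l x 0 i = cell l y 0 i by rewrite xk yk.
rewrite !mxE => e.
have := (floor_itv (2 ^+ l * x 0 i), floor_itv (2 ^+ l * y 0 i)).
rewrite e intrD => -[/andP[h1 h2] /andP[h3 h4]].
rewrite -(real_normK (num_real _)) ler_sqr ?nnegrE ?invr_ge0 ?(ltW l0) //.
rewrite -[leRHS]mul1r ler_pdivlMr // -(gtr0_norm l0) -normrM.
by rewrite ler_norml; nra.
Qed.

(** The content allows large cubes, but a cover of small total cost contains only small ones. *)
Lemma net_content0_hausdorff (R : realType) (n : nat) (t : R)
  (A : set 'rV[R]_n) :
  0 < t -> net_content (2 `^ (- t)) A = 0%E -> hausdorff_measure t A = 0%E.
Proof.
move=> t0 A0; pose a : R := 2 `^ (- t).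
have a0 : 0 < a by rewrite powR_gt0.
apply: hausdorff_measure_eq0 => delta d0; apply/lee_addgt0Pr => e e0.
rewrite add0e; pose K := n%:R `^ t : R.
have K0 : 0 <= K by rewrite powR_ge0.
(* The first bound keeps the gauge sum below e; the second forces every cube of the cover to have
   diameter at most [delta]. *)
pose e' := Num.min (e / (K + 1)) ((delta / (n%:R + 1)) `^ t).
have e'0 : 0 < e'.
  by rewrite lt_min divr_gt0 ?powR_gt0 ?divr_gt0 ?ltr_wpDl.
have [_ [C AC <-] lt] : exists2 c, [set net_cost a C | C in net_cover A] c & (c < e'%:E)%E.
  by apply: ereal_inf_lt; rewrite -/(net_content a A) A0 lte_fin.
pose cub (Q : nat * 'rV[int]_n) := [set x : 'rV[R]_n | cell Q.1 x = Q.2].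
(* Indices that code no cube of [C] give the empty set, whose gauge is 0. *)
pose F i := if pickle_inv i is Some Q then if Q \in C then cub Q else set0 else set0.
have small Q : C Q -> (ediam (cub Q) <= delta%:E)%E.
  move=> CQ; apply: le_trans (ediam_cell _ _ _) _; rewrite lee_fin.
  have aQ : a ^+ Q.1 <= e'.
    rewrite -lee_fin; apply: le_trans (ltW lt).
    have -> : (a ^+ Q.1)%:E = (\sum_(q \in [set Q]) (a ^+ q.1)%:E)%E by rewrite fsbig_set1.
    by apply: esum_ge; exists [set Q] => //; split=> // _ ->.
  have : ((2 ^+ Q.1)^-1) `^ t <= (delta / (n%:R + 1)) `^ t.
    by rewrite -powR_half_expr; apply: le_trans aQ _; rewrite ge_min lexx orbT.
  rewrite leNgt => h; rewrite leNgt; apply: contra h => h; apply: gt0_ltr_powR => //.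
  - by rewrite nnegrE divr_ge0 ?(ltW d0) // addr_ge0.
  - by rewrite nnegrE invr_ge0 exprn_ge0.
  rewrite ltr_pdivrMr ?ltr_wpDl //; apply: lt_le_trans h _.
  rewrite mulrC ler_wpM2l ?invr_ge0 ?exprn_ge0 //.
  by rewrite lerDl.
have Fd i : (ediam (F i) <= delta%:E)%E.
  rewrite /F; case: (pickle_inv i) => [Q|]; last by rewrite /ediam setX0 image_set0 ereal_sup0 leNye.
  case: ifP => [/set_mem /small //|_].
  by rewrite /ediam setX0 image_set0 ereal_sup0 leNye.
apply: ge_ereal_inf; exists (\sum_(0 <= i <oo) hgauge t (F i))%E.
  exists F => //; split=> // x /AC [l Cl]; exists (pickle (l, cell l x)) => //.
  by rewrite /F pickleK_inv mem_set.
have g0 i : (0 <= hgauge t (F i))%E by exact: hgauge_ge0.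
rewrite nneseries_esumT //.
have -> : (\esum_(i in [set: nat]) hgauge t (F i) =
           \esum_(i in [set pickle Q | Q in C]) hgauge t (F i))%E.
  rewrite [RHS]esum_mkcond; apply: eq_esum => i _; case: ifPn => //.
  have := @pickle_invK (nat * 'rV[int]_n)%type i; rewrite /F.
  case: (pickle_inv i) => [Q|] /= eQ nC; last by rewrite /hgauge eqxx.
  case: ifPn => QC; last by rewrite /hgauge eqxx.
  exfalso; move: nC; rewrite notin_setE; apply; by exists Q; [exact: set_mem QC|exact: eQ].
rewrite esum_image; last by move=> Q Q' _ _; apply: (pcan_inj pickleK).
apply: (@le_trans _ _ (K%:E * net_cost a C)%E).
  apply: (@le_trans _ _ (\esum_(Q in C) (K%:E * (a ^+ Q.1)%:E))%E).
    apply: le_esum => Q CQ; rewrite /F pickleK_inv mem_set // -EFinM.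
    have l0 : 0 <= (2 ^+ Q.1)^-1 :> R by rewrite invr_ge0 exprn_ge0.
    rewrite powR_half_expr -powRM //.
    by apply: hgauge_le_powR; [exact: ltW|rewrite mulr_ge0 ?ler0n|exact: ediam_cell].
  apply: ge_ereal_sup => _ [X [finX XC] <-].
  rewrite -ge0_mule_fsumr; last by move=> Q; rewrite lee_fin exprn_ge0 // ltW.
  by apply: lee_wpmul2l; [rewrite lee_fin|apply: esum_ge; exists X].
apply: (@le_trans _ _ (K%:E * e'%:E)%E).
  by apply: lee_wpmul2l; [rewrite lee_fin|exact: ltW].
rewrite -EFinM lee_fin; have : e' <= e / (K + 1) by rewrite ge_min lexx.
rewrite ler_pdivlMr ?ltr_wpDl //; nra.
Qed.

(** * Projections onto tangent hyperplanes of the sphere *)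

Lemma mulmx_trE (R : realType) (n : nat) (u v : 'rV[R]_n) :
  u *m v^T = (edot u v)%:M.
Proof.
apply/matrixP => i j; rewrite !ord1 !mxE eqxx mulr1n.
by apply: eq_bigr => k _; rewrite mxE.
Qed.

Lemma edot_eq0 (R : realType) (n : nat) (u : 'rV[R]_n) : edot u u = 0 -> u = 0.
Proof.
move=> uu; apply/rowP => i; rewrite mxE; apply/eqP.
by rewrite -sqrf_eq0 eq_le sqr_ge0 andbT -uu edot_ge_sqr.
Qed.

Lemma orthproj_tangent_sphere (R : realType) (n : nat) (x z : 'rV[R]_n) :
  enorm x = 1 -> z *m orthproj (tangent_sphere x) = sproj x z.
Proof.
move=> x1; have xx : edot x x = 1 by rewrite -sqr_enorm x1 expr1n.
pose W := tangent_sphere x.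
have WT : W *m x^T = 0 by apply/sub_kermxP.
(* [proj_mx] needs independent summands: a vector in both is orthogonal to itself. *)
have dx : (<<W>> :&: orthc W = 0)%MS.
  apply/eqP; rewrite -submx0; apply/rV_subP => v; rewrite sub_capmx genmxE.
  move=> /andP[/submxP[u vu] /sub_kermxP vW].
  rewrite submx0; apply/eqP/edot_eq0.
  have : v *m v^T = 0 by rewrite [in X in _ *m X]vu trmx_mul mulmxA vW mul0mx.
  by rewrite mulmx_trE => /matrixP/(_ 0 0); rewrite !mxE eqxx mulr1n.
have zE : z = sproj x z + edot z x *: x by rewrite /sproj subrK.
rewrite [in LHS]zE mulmxDl -scalemxAl /orthproj -/W proj_mx_id //.
  rewrite proj_mx_0 ?scaler0 ?addr0 //; apply/sub_kermxP.
  by apply: trmx_inj; rewrite trmx_mul trmxK WT trmx0.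
rewrite genmxE; apply/sub_kermxP; rewrite mulmx_trE /sproj edotDl edotNl edotZl xx.
by rewrite mulr1 subrr raddf0.
Qed.

Lemma tprojE (R : realType) (n : nat) (x : 'rV[R]_n) (Z : set 'rV[R]_n) :
  enorm x = 1 -> tproj x Z = sproj x @` Z.
Proof.
move=> x1; rewrite /tproj; apply: eq_imagel => z _.
exact: orthproj_tangent_sphere.
Qed.

Lemma sproj_lipschitz (R : realType) (n : nat) (x u v : 'rV[R]_n) :
  enorm x = 1 -> enorm (sproj x u - sproj x v) <= enorm (u - v).
Proof.
move=> x1; rewrite -sprojB -ler_sqr ?nnegrE ?enorm_ge0 // sqr_enorm_sproj //.
by rewrite sqr_enorm gerBl sqr_ge0.
Qed.

(** * From null projections to tubes *)

Lemma ltr_powR2 (R : realType) (x y : R) : x < y -> 2 `^ x < 2 `^ y.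
Proof.
move=> xy; rewrite /powR gt_eqF // ltr_expR ltr_pM2r // ln_gt0 //.
by rewrite ltr1n.
Qed.

Lemma powR2_lt1 (R : realType) (s : R) : 0 < s -> 2 `^ (- s) < 1.
Proof.
move=> s0; have : - s < 0 by rewrite oppr_lt0.
by move/ltr_powR2; rewrite powRr0.
Qed.

(** For d > 0, l is the last level with 2^-l > d, so 2^-(l+1) <= d. For d = 0 there is no last
    level, and [e] pays for a tube of positive width. *)
Lemma dyadic_scale (R : realType) (s d e : R) :
  0 < s -> 0 <= d -> d < 1 -> 0 < e -> exists l, d < (2 ^+ l)^-1 /\
    (2 `^ (- s)) ^+ l <= d `^ s / 2 `^ (- s) + e.
Proof.
move=> s0 d0 d1 e0; pose b : R := 2 `^ (- s).
have b0 : 0 < b by rewrite powR_gt0.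
have b1 : b < 1 by exact: powR2_lt1.
move: d0; rewrite le_eqVlt => /orP[/eqP <-|d0].
  have [l bl] := expr_small (ltW b0) b1 e0.
  exists l; rewrite invr_gt0 exprn_gt0 //; split=> //.
  by rewrite powR0 ?gt_eqF // mul0r add0r ltW.
have half : (2^-1 : R) < 1 by rewrite invf_lt1 // ltr1n.
have half0 : 0 <= 2^-1 :> R by rewrite invr_ge0.
have [N dN] := expr_small half0 half d0.
have ex : exists l, (2 ^+ l)^-1 <= d.
  by exists N; rewrite -exprVn ltW.
case: (ex_minnP ex) => [[|l]] le lmin.
  by move: le; rewrite expr0 invr1 leNgt d1.
exists l; split.
  by rewrite ltNge; apply/negP => /lmin; rewrite ltnn.
rewrite -/b -[leLHS]addr0; apply: lerD; last exact: ltW.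
rewrite ler_pdivlMr // -exprSr powR_half_expr; apply: ge0_ler_powR => //.
- exact: ltW.
- by rewrite nnegrE invr_ge0 exprn_ge0.
- by rewrite nnegrE ltW.
Qed.

(** A set of a cover of the projection becomes a tube around a point of [Z] that projects into it,
    with the radius given by [dyadic_scale]. *)
Lemma tubes_of_null_image (R : realType) (n : nat) (s : R) (x : 'rV[R]_n)
  (Z : set 'rV[R]_n) (j0 : nat) :
  0 < s -> hausdorff_measure s (sproj x @` Z) = 0%E ->
  exists (c : nat -> 'rV[R]_n) (l : nat -> nat),
    (forall z, Z z -> exists i, enorm (sproj x (z - c i)) < (2 ^+ l i)^-1) /\
    forall N, \sum_(i < N) (2 `^ (- s)) ^+ l i <= (2 `^ (- s)) ^+ j0.
Proof.
move=> s0 pZ0; pose b : R := 2 `^ (- s).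
have b0 : 0 < b by rewrite powR_gt0.
have half0 : 0 < 2^-1 :> R by rewrite invr_gt0.
pose q := b ^+ j0; have q0 : 0 < q by rewrite exprn_gt0.
(* Of the budget q, half goes to the gauge sum divided by b, and half to the corrections q/2^(i+2).
   Diameters at most 1/2 are below 1, as [dyadic_scale] requires. *)
have P0 : (hausdorff_premeasure s 2^-1 (sproj x @` Z) < (b * q / 2)%:E)%E.
  apply: le_lt_trans (hausdorff_premeasure_le_measure s _ half0) _.
  by rewrite pZ0 lte_fin divr_gt0 // mulr_gt0.
have [_ [F [ZF Fd] <-] lt] := ereal_inf_lt P0.
have eta0 i : 0 < q * 2^-1 ^+ i.+2 by rewrite mulr_gt0 // exprn_gt0.
have /choice[p pP] : forall i, exists p : 'rV[R]_n * nat,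
    (forall z, Z z -> F i (sproj x z) ->
       enorm (sproj x (z - p.1)) < (2 ^+ p.2)^-1) /\
    ((b ^+ p.2)%:E <= hgauge s (F i) * (b^-1)%:E + (q * 2^-1 ^+ i.+2)%:E)%E.
  move=> i; have [[z0 [Zz0 Fz0]]|none] := pselect (exists z, Z z /\ F i (sproj x z)).
    move: (ediam_ge0 Fz0) (Fd i); case E : (ediam (F i)) => [d||] //.
    rewrite !lee_fin => d0 dhalf.
    have d1 : d < 1 by apply: le_lt_trans dhalf _; rewrite invf_lt1 // ltr1n.
    have [l [dl bl]] := dyadic_scale s0 d0 d1 (eta0 i).
    exists (z0, l); split=> /= [z Zz Fz|].
      apply: le_lt_trans dl; rewrite sprojB -lee_fin -E.
      exact: le_ediam.
    rewrite /hgauge ifF; last by apply/negP => /eqP F0; rewrite F0 in Fz0.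
    by rewrite E poweR_EFin -EFinM -EFinD lee_fin.
  (* A member of the cover that misses the projection still gets some tube, paid for by the
     correction. *)
  have d01 : (0 : R) < 1 by [].
  have [l [_ bl]] := dyadic_scale s0 (lexx 0) d01 (eta0 i).
  exists (0, l); split=> /= [z Zz Fz|]; first by case: none; exists z.
  apply: (@le_trans _ _ (q * 2^-1 ^+ i.+2)%:E).
    by move: bl; rewrite powR0 ?gt_eqF // mul0r add0r lee_fin.
  by rewrite leeDr // mule_ge0 ?hgauge_ge0 // lee_fin invr_ge0 ltW.
exists (fun i => (p i).1), (fun i => (p i).2); split.
  move=> z Zz; have [|i _ Fz] := ZF (sproj x z); first by exists z.
  by exists i; case: (pP i) => h _; exact: h.
move=> N; rewrite -lee_fin -sumEFin.
apply: (@le_trans _ _ (\sum_(i < N) (hgauge s (F i) * (b^-1)%:E +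
    (q * 2^-1 ^+ i.+2)%:E))%E).
  by apply: lee_sum => i _; case: (pP i).
rewrite big_split /= -ge0_sume_distrl; last by move=> i _; exact: hgauge_ge0.
have S1 : (\sum_(i < N) hgauge s (F i) <= (b * q / 2)%:E)%E.
  apply: le_trans (ltW lt); rewrite -(big_mkord xpredT (fun i => hgauge s (F i))).
  by apply: nneseries_lim_ge => i _ _; exact: hgauge_ge0.
apply: (@le_trans _ _ ((b * q / 2)%:E * (b^-1)%:E + (q / 2)%:E)%E).
  apply: leeD.
    by apply: lee_wpmul2r => //; rewrite lee_fin invr_ge0 ltW.
  rewrite sumEFin lee_fin -mulr_sumr ler_pM2l //.
  under eq_bigr do rewrite 2!exprS mulrA.
  rewrite -mulr_sumr.
  have := @geometric_tail_le R 2^-1 0 N (ltW half0).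
  rewrite big_mkord expr0 invf_lt1 // ltr1n => /(_ isT).
  have -> : 1 / (1 - 2^-1) = 2 :> R by field.
  set S := \sum_(i < N) _; lra.
rewrite -EFinM -EFinD lee_fin -/q.
have -> : b * q / 2 * b^-1 + q / 2 = q by field; exact: lt0r_neq0.
exact: lexx.
Qed.

(** Any u strictly between t and dim Z gives [Z] nonzero content, since null content would make the
    u-dimensional measure vanish. *)
Lemma net_content_exceptional (R : realType) (n : nat) (s t : R)
  (Z E : set 'rV[R]_n) :
  analytic_set Z -> 0 < s -> s < t -> (t%:E < hausdorff_dim Z)%E ->
  (forall x, E x -> enorm x = 1 /\ (hausdorff_dim (tproj x Z) < s%:E)%E) ->
  net_content (2 `^ (- t)) E = 0%E.
Proof.
move=> Zan s0 st tZ EZ; have t0 := lt_trans s0 st.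
have content_neq0 (u : R) : 0 < u -> (u%:E < hausdorff_dim Z)%E ->
    net_content (2 `^ (- u)) Z <> 0%E.
  move=> u0 uZ /(net_content0_hausdorff u0)/(hausdorff_dim_le (ltW u0)).
  by rewrite leNgt uZ.
case: Zan => [Z0|[f [cf fZ]]].
  by case: (content_neq0 t t0 tZ); rewrite Z0 net_content_set0 // powR_ge0.
have [u [tu uZ]] : exists u, t < u /\ (u%:E < hausdorff_dim Z)%E.
  move: tZ; case: (hausdorff_dim Z) => [r||] //.
    by rewrite lte_fin => tr; exists ((t + r) / 2); rewrite lte_fin; split; lra.
  by move=> _; exists (t + 1); rewrite ltry; split=> //; lra.
have u0 := lt_trans t0 tu.
apply: (@tubes_content0 _ _ _ (2 `^ (- s)) (2 `^ (- u)) Z E f) => //.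
- by apply: ltr_powR2; rewrite ltrN2.
- by apply: ltr_powR2; rewrite ltrN2.
- exact: powR2_lt1.
- exact: content_neq0.
- by move=> x /EZ[].
move=> x /EZ[x1]; rewrite tprojE // => /hausdorff_dim_lt[_ H0] j0.
exact: tubes_of_null_image.
Qed.

Theorem theorem1p5 (R : realType) (n : nat) (Z Sigma : set 'rV[R]_n)
  (n_ge3 : (3 <= n)%N)
  (Z_analytic : analytic_set Z)
  (dimZ : (hausdorff_dim Z <= (n - 2)%:R%:E)%E)
  (Sigma_sphere : Sigma `<=` sphere R n)
  (Sigma_C2 : C2_submanifold (n - 2) Sigma)
  (Sigma_geodesic : n = 3%N -> nonvanishing_geodesic_curvature Sigma)
  (Sigma_sectional : (4 <= n)%N -> sectional_curvature_gt1 (n - 2) Sigma) :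
  (forall s : R, 0 < s -> (s%:E < hausdorff_dim Z)%E ->
     (hausdorff_dim [set x | Sigma x /\
        (hausdorff_dim (tproj x Z) < s%:E)%E] <= s%:E)%E) /\
  hausdorff_measure (n - 2)%:R
    [set x | Sigma x /\ hausdorff_dim (tproj x Z) <> hausdorff_dim Z] = 0%E.
Proof.
have n2 : 0 < (n - 2)%:R :> R by rewrite ltr0n subn_gt0.
have dfin : hausdorff_dim Z \is a fin_num.
  by rewrite ge0_fin_numE ?hausdorff_dim_ge0 // (le_lt_trans dimZ) // ltry.
have dE := fineK dfin; set d := fine _ in dE.
rewrite -dE lee_fin in dimZ; rewrite -dE; split=> [s s0|].
  rewrite lte_fin => sd; apply/lee_addgt0Pr => e e0.
  (* An exponent strictly between s and d and at most s + e, for which the exceptional set is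
     null. *)
  pose t := Num.min (s + e) ((s + d) / 2).
  have st : s < t by rewrite lt_min; apply/andP; split; lra.
  have td : t < d by rewrite gt_min; apply/orP; right; lra.
  have t0 := lt_trans s0 st.
  apply: (@le_trans _ _ t%:E); last by rewrite -EFinD lee_fin ge_min lexx.
  apply: hausdorff_dim_le; first exact: ltW.
  apply: net_content0_hausdorff => //.
  apply: (@net_content_exceptional _ _ s t Z) => //; first by rewrite -dE.
  by move=> x [/Sigma_sphere].
(* A drop in dimension is witnessed by a rational strictly between the two dimensions; [pickle]
   indexes the resulting countable union. *)
pose A m := [set x | Sigma x /\ exists q : rat, [/\ pickle q = m,
  (hausdorff_dim (tproj x Z) < (ratr q)%:E)%E & ratr q < d]].
have a0 : 0 <= 2 `^ (- (n - 2)%:R) :> R by exact: powR_ge0.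
apply: net_content0_hausdorff => //; apply/eqP.
rewrite eq_le net_content_ge0 // andbT.
apply: (@le_trans _ _ (net_content (2 `^ (- (n - 2)%:R)) (\bigcup_m A m))).
  apply: le_net_content => x [Sx xd].
  (* Projections are 1-Lipschitz, so the dimension can only drop. *)
  have lt : (hausdorff_dim (tproj x Z) < d%:E)%E.
    rewrite lt_neqAle; apply/andP; split; first exact/eqP.
    rewrite dE tprojE; last exact: Sigma_sphere.
    by apply: hausdorff_dim_image => u v; apply/sproj_lipschitz/Sigma_sphere.
  have xfin : hausdorff_dim (tproj x Z) \is a fin_num.
    by rewrite ge0_fin_numE ?hausdorff_dim_ge0 // (lt_le_trans lt) // leey.
  move: lt; rewrite -(fineK xfin) lte_fin => /rat_in_itvoo[q].
  rewrite in_itv /= => /andP[xq qd]; exists (pickle q) => //; split=> //.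
  by exists q; split=> //; rewrite -(fineK xfin) lte_fin.
rewrite net_content_bigcup0 // => m; apply/eqP.
rewrite eq_le net_content_ge0 // andbT.
have [[x [Sx [q [qm xq qd]]]]|none] := pselect (exists x, A m x); last first.
  have -> : A m = set0 by apply/seteqP; split=> // x Ax; case: none; exists x.
  by rewrite net_content_set0.
have q0 : 0 < ratr q :> R.
  by rewrite -lte_fin; apply: le_lt_trans xq; exact: hausdorff_dim_ge0.
(* As t < d <= n - 2, null content for t passes to the exponent n - 2. *)
pose t := (ratr q + d) / 2.
have [qt td] : ratr q < t /\ t < d by rewrite /t; split; lra.
have At : net_content (2 `^ (- t)) (A m) = 0%E.
  apply: (net_content_exceptional Z_analytic q0 qt); first by rewrite -dE lte_fin.
  move=> y [Sy [q' [q'm yq' _]]]; split; first exact: Sigma_sphere.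
  by have -> : q = q' by apply: (pcan_inj pickleK); rewrite qm q'm.
apply: le_trans (_ : (_ <= net_content (2 `^ (- t)) (A m))%E) _; last by rewrite At.
apply: net_content_mono => //; apply/ltW/ltr_powR2.
by rewrite ltrN2 (lt_le_trans td).
Qed.
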